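(* Let $d\ge1$, let $P$ be a (hanging) rooted tree poset on $[d]=\{1,\dots,d\}$ and let $s\colon[d]\to\mathbb{N}$ be any map to the positive integers. Then the $h^\ast$-polynomial of the $s$-lecture hall order polytope $\mathcal{O}(P,s)$ is real-rooted, i.e. all of its complex zeros are real.
   Context: A (hanging) rooted tree on $[d]$ is a poset $P=([d],\preceq)$ whose Hasse diagram is a tree with the root at the top: there is a unique maximal element (the root), and every other element is covered by exactly one element. The labels in $[d]$ are arbitrary, i.e. they need not be compatible with $\preceq$. Let $P=([d],\preceq)$ be a poset on $[d]$ and $s\colon[d]\to\mathbb{N}$ a map to the positive integers. A map $f\colon[d]\to\mathbb{R}$ (identified with a vector in $\mathbb{R}^d$) is called a $(P,s)$-partition if $f(i)/s(i)\le f(j)/s(j)$ whenever $i\prec j$, and $f(i)/s(i)<f(j)/s(j)$ whenever $i\prec j$ and $i>j$ as integers. The $s$-lecture hall order polytope $\mathcal{O}(P,s)\subset\mathbb{R}^d$ is the (in general half-open) $d$-dimensional polytope of all $(P,s)$-partitions $f\in\mathbb{R}^d$ with $0\le f(i)/s(i)\le 1$ for all $i\in[d]$. For an integer $n\ge0$, its $n$-th dilate $n\mathcal{O}(P,s)$ is the set of all $(P,s)$-partitions $f\in\mathbb{R}^d$ with $0\le f(i)/s(i)\le n$ for all $i$. The Ehrhart function $\mathrm{E}_{\mathcal{O}(P,s)}(n)=|n\mathcal{O}(P,s)\cap\mathbb{Z}^d|$, $n\ge0$, is given by a polynomial in $n$ of degree $d$. The $h^\ast$-polynomial $h^\ast(t)$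 of $\mathcal{O}(P,s)$ is defined by $$\sum_{n\ge0}\mathrm{E}_{\mathcal{O}(P,s)}(n)\,t^n=\frac{h^\ast(t)}{(1-t)^{d+1}} .$$ *)

(* Defs.v *)
From mathcomp Require Import all_boot all_order all_algebra.
From mathcomp Require Import finmap.
From mathcomp Require Import classical_sets cardinality reals.
From mathcomp Require Import complex.

Set Implicit Arguments.
Unset Strict Implicit.
Unset Printing Implicit Defensive.

Import Order.TTheory GRing.Theory Num.Theory.
Local Open Scope classical_set_scope.
Local Open Scope ring_scope.

(* The label set [d] = {1, ..., d} is represented by 'I_d = {0, ..., d - 1},
   i.e. labels are shifted by one; only their relative order matters. *)

Section Poset.
Variables (d : nat) (rel_P : rel 'I_d).

Definition partial_order : Prop :=
  [/\ reflexive rel_P, antisymmetric rel_P & transitive rel_P].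

Definition strict (i j : 'I_d) : bool := (i != j) && rel_P i j.

Definition covered_by (i j : 'I_d) : Prop :=
  strict i j /\ ~ exists k, strict i k /\ strict k j.

Definition maximal (m : 'I_d) : Prop := forall i, ~ strict m i.

Definition rooted_tree : Prop :=
  partial_order /\
  exists root : 'I_d,
    [/\ maximal root,
        forall m, maximal m -> m = root
      & forall i, i <> root -> exists! j, covered_by i j].

End Poset.

Section LectureHall.
Variables (R : realType) (d : nat) (rel_P : rel 'I_d) (s : 'I_d -> nat).

Definition Ps_partition (f : {ffun 'I_d -> R}) : Prop :=
  (forall i j, strict rel_P i j -> f i / (s i)%:R <= f j / (s j)%:R) /\
  (forall i j, strict rel_P i j -> (j < i)%N ->
     f i / (s i)%:R < f j / (s j)%:R).

(* The n-th dilate of O(P, s); n = 1 gives O(P, s) itself.  For n = 0 this is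
   empty, rather than {0}, as soon as i precedes j for some labels i > j. *)
Definition lecture_hall_dilate (n : nat) : set {ffun 'I_d -> R} :=
  [set f | Ps_partition f /\ forall i, 0 <= f i / (s i)%:R <= n%:R].

Definition integer_lattice : set {ffun 'I_d -> R} :=
  [set f | forall i, f i \is a Num.int].

(* [fset_set] is the junk value [fset0] on infinite sets; the set below is
   bounded, hence finite, when s is positive. *)
Definition ehrhart (n : nat) : nat :=
  #|` fset_set (lecture_hall_dilate n `&` integer_lattice)|%fset.

(* The identity of formal power series
   (1 - t)^(d+1) * \sum_(n >= 0) ehrhart n t^n = h(t), coefficientwise;
   it determines h. *)
Definition is_hstar (h : {poly int}) : Prop :=
  forall n : nat,
    h`_n = \sum_(k < n.+1) ((1 - 'X : {poly int}) ^+ d.+1)`_k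
                           * (ehrhart (n - k))%:Z.

End LectureHall.

(* [Num.real] on R[i] is the set of complex numbers comparable with 0, i.e.
   those with zero imaginary part.  The zero polynomial is not real-rooted. *)
Definition real_rooted (R : realType) (h : {poly int}) : Prop :=
  forall z : R[i], root (map_poly intr h) z -> z \is Num.real.

(* Main.v *)
(* Write E(n) = \sum_(x <= n s_root) W(x), where W(x) counts the partitions of
   the tree whose root has value x.  Eliminating a leaf u with parent p
   replaces the weight W_p(y) by W_p(y) * \sum_(x < c(y)) W_u(x), where
   c(y) is y s_u / s_p rounded suitably, so it is enough to control this
   operation.  For each residue i mod s_u the function n |-> W_u(n s_u + i) has
   a numerator h_i over (1 - t)^(D+1), and the invariant is that for every z in
   the upper half-plane the values h_(s-1)(z), ..., h_0(z) occur in this order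
   of arguments in the sector spanned by G(z) and z G(z), for some polynomial
   G of degree less than D.  Partial summation turns h into
   \sum_(j < i) h_j + t \sum_(j >= i) h_j, and the invariant follows by
   bilinearity of the cross product.  Products of weights are governed by
   Wagner's product of h*-polynomials: its value at z is a coefficient of a
   polynomial of degree D + E all of whose zeros lie in a half-plane not
   containing 0, which is nonzero by Gauss-Lucas.  Since this holds for complex
   combinations f1 + w f2 in place of f, multiplication by a fixed factor
   preserves interlacing; varying one factor at a time gives the sector
   property for products. *)

Require Import Defs.
From mathcomp Require Import all_boot all_order all_algebra.
From mathcomp Require Import reals complex.
From mathcomp Require Import zify ring lra.

Set Implicit Arguments.
Unset Strict Implicit.
Unset Printing Implicit Defensive.

Import Order.TTheory GRing.Theory Num.Theory.
Local Open Scope ring_scope.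

(** * Ehrhart functions and the product of h*-polynomials *)

Section Binomials.
Local Open Scope nat_scope.

Lemma mul_bin_comm n j a :
  'C(n, j + a) * 'C(j + a, j) = 'C(n, j) * 'C(n - j, a).
Proof.
have [lt_n|le_n] := ltnP n (j + a).
  rewrite bin_small // mul0n.
  have [ltnj|lejn] := ltnP n j; first by rewrite bin_small.
  by rewrite (@bin_small (n - j)) ?muln0 //; lia.
have e1 := bin_fact le_n; have e2 := bin_fact (leq_addr a j).
have lejn : j <= n by lia.
have lea : a <= n - j by lia.
have e3 := bin_fact lejn; have e4 := bin_fact lea.
rewrite addKn in e2; rewrite -subnDA in e4.
have P0 : 0 < j`! * a`! * (n - (j + a))`! by rewrite !muln_gt0 !fact_gt0.
apply/eqP; rewrite -(eqn_pmul2r P0); apply/eqP.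
transitivity n`!.
  by rewrite -e1 -e2; ring.
by rewrite -e3 -e4; ring.
Qed.

(** Vandermonde splits the last binomial over j; trinomial revision ([mul_bin_comm]) then turns the
    sum over k, and finally the sum over j, into Vandermonde convolutions. *)
Lemma riordan_bin P Q r s m n : P + r = m + s -> P + Q = m + n ->
  \sum_(k < n.+1) 'C(P, k) * 'C(Q, n - k) * 'C(r + k, m + n)
  = 'C(r, m) * 'C(s, n).
Proof.
move=> Prms PQmn.
have splitC (k : 'I_n.+1) :
  'C(r + k, m + n) = \sum_(j < n.+1) 'C(k, j) * 'C(r, m + n - j).
  rewrite addnC -binomial.Vandermonde -!(big_mkord xpredT (fun j =>
    'C(k, j) * 'C(r, m + n - j))).
  rewrite (big_cat_nat (n := n.+1)) //=; last by lia.
  rewrite [X in _ + X]big_nat_cond [X in _ + X]big1 ?addn0 // => j.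
  by rewrite andbT => /andP[nj _]; rewrite bin_small //; have := ltn_ord k; lia.
under eq_bigr do rewrite splitC big_distrr /=.
rewrite exchange_big /=.
have inner (j : 'I_n.+1) :
  \sum_(k < n.+1) 'C(P, k) * 'C(Q, n - k) * ('C(k, j) * 'C(r, m + n - j))
  = 'C(r, m) * ('C(P, j) * 'C(r - m, n - j)).
  have lejn : j <= n by have := ltn_ord j; lia.
  have [ltPj|lejP] := ltnP P j.
    rewrite (bin_small ltPj) mul0n muln0 big1 // => k _.
    have [ltkj|lejk] := ltnP k j; first by rewrite (bin_small ltkj) mul0n muln0.
    by rewrite (@bin_small P k) ?mul0n //; lia.
  have -> :
    \sum_(k < n.+1) 'C(P, k) * 'C(Q, n - k) * ('C(k, j) * 'C(r, m + n - j))
    = 'C(r, m + n - j) *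
      ('C(P, j) * \sum_(a < (n - j).+1) 'C(P - j, a) * 'C(Q, n - j - a)).
    rewrite -(big_mkord xpredT (fun k =>
      'C(P, k) * 'C(Q, n - k) * ('C(k, j) * 'C(r, m + n - j)))).
    rewrite (big_cat_nat (n := j)) //=; last by lia.
    rewrite [X in X + _]big_nat_cond [X in X + _]big1 ?add0n; last first.
      by move=> k; rewrite andbT => /andP[_ kj];
        rewrite (bin_small kj) mul0n muln0.
    rewrite -{1}(add0n (j : nat)) big_addn subSn // big_mkord !big_distrr /=.
    apply: eq_bigr => a _.
    rewrite (addnC (a : nat)) subnDA.
    transitivity ('C(r, m + n - j) * ('C(P, j) * 'C(P - j, a))
      * 'C(Q, n - j - a)); last by ring.
    by rewrite -mul_bin_comm; ring.
  rewrite binomial.Vandermonde.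
  have -> : P - j + Q = m + (n - j) by lia.
  have -> : 'C(m + (n - j), n - j) = 'C(m + (n - j), m).
    by rewrite -bin_sub ?leq_addl // addnK.
  have -> : m + n - j = m + (n - j) by lia.
  transitivity ('C(P, j) * ('C(r, m + (n - j)) * 'C(m + (n - j), m)));
    first by ring.
  by rewrite mul_bin_comm; ring.
under eq_bigr do rewrite inner.
rewrite -big_distrr /= binomial.Vandermonde.
have [ltrm|lemr] := ltnP r m; first by rewrite (bin_small ltrm).
by have -> : P + (r - m) = s by lia.
Qed.

End Binomials.

Section Ehr.
Variable A : comNzRingType.
Implicit Types (f g h : {poly A}) (n D E : nat).

(* The coefficient of t^n in h(t) / (1 - t)^(D+1), for h of degree at most D. *)
Definition ehr D h n : A := \sum_(i < D.+1) h`_i * 'C(n + D - i, D)%:R.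

(* The coefficient of 'X^m is the number of shuffles with m descents of two
   words of lengths D and E with i and j descents. *)
Definition hstar_mon D E i j : {poly A} :=
  \sum_(k < E.+1)
    ('C(E + i - j, k) * 'C(D + j - i, E - k))%:R *: 'X^(E + i - k).

(** Wagner's product, extended bilinearly from monomials: the numerator of the termwise product of
    two series, see [ehr_mul]. *)
Definition hstar_mul D E f g : {poly A} :=
  \sum_(i < D.+1) \sum_(j < E.+1) (f`_i * g`_j) *: hstar_mon D E i j.

Lemma ehrD D f g n : ehr D (f + g) n = ehr D f n + ehr D g n.
Proof. by rewrite -big_split; apply: eq_bigr => i _; rewrite coefD mulrDl. Qed.

Lemma ehrZ D a f n : ehr D (a *: f) n = a * ehr D f n.
Proof. by rewrite mulr_sumr; apply: eq_bigr => i _; rewrite coefZ mulrA. Qed.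

Lemma ehr0 D n : ehr D 0 n = 0.
Proof. by rewrite /ehr big1 // => i _; rewrite coef0 mul0r. Qed.

Lemma ehr_sum D I (r : seq I) (P : pred I) (F : I -> {poly A}) n :
  ehr D (\sum_(i <- r | P i) F i) n = \sum_(i <- r | P i) ehr D (F i) n.
Proof.
exact: (big_morph (fun h => ehr D h n) (fun f g => ehrD D f g n) (ehr0 D n)).
Qed.

Lemma ehrXn D k n : (k <= D)%N -> ehr D 'X^k n = 'C(n + D - k, D)%:R.
Proof.
move=> kD; rewrite /ehr (bigD1 (Ordinal (kD : (k < D.+1)%N)))
  //= coefXn eqxx mul1r.
rewrite big1 ?addr0 // => i; rewrite -val_eqE /= => ik.
by rewrite coefXn (negPf ik) mul0r.
Qed.

Lemma ehr_mon D E i j n : (i <= D)%N -> (j <= E)%N ->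
  ehr (D + E) (hstar_mon D E i j) n
  = ('C(n + D - i, D) * 'C(n + E - j, E))%:R.
Proof.
move=> iD jE; rewrite ehr_sum.
rewrite -(@riordan_bin (E + i - j) (D + j - i)) ?natr_sum; try by lia.
apply: eq_bigr => k _; have := ltn_ord k => kE.
rewrite ehrZ ehrXn; last by lia.
by rewrite -natrM; congr ((_ * 'C(_, _))%:R); lia.
Qed.

Lemma ehr_mul D E f g n :
  ehr (D + E) (hstar_mul D E f g) n = ehr D f n * ehr E g n.
Proof.
rewrite ehr_sum mulr_suml; apply: eq_bigr => i _.
rewrite ehr_sum mulr_sumr; apply: eq_bigr => j _.
by rewrite ehrZ ehr_mon ?leq_ord // natrM mulrACA.
Qed.

(** The system is unitriangular: the n-th coefficient enters the n-th value with factor 1, and later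
    coefficients do not enter it. *)
Lemma ehr_inj D f g : (size f <= D.+1)%N -> (size g <= D.+1)%N ->
  (forall n, ehr D f n = ehr D g n) -> f = g.
Proof.
move=> sf sg eqfg; apply/polyP; elim/ltn_ind => n IHn.
have [ltnD|leDn] := ltnP n D.+1; last first.
  by rewrite !nth_default //; apply: leq_trans leDn.
have := eqfg n; rewrite /ehr (bigD1 (Ordinal ltnD)) //=.
rewrite [X in _ = X](bigD1 (Ordinal ltnD)) //=.
have -> : (n + D - n = D)%N by lia.
rewrite binn !mulr1.
have -> : \sum_(i < D.+1 | i != Ordinal ltnD) f`_i * 'C(n + D - i, D)%:R
        = \sum_(i < D.+1 | i != Ordinal ltnD) g`_i * 'C(n + D - i, D)%:R.
  apply: eq_bigr => i; rewrite -val_eqE /= => nei.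
  have [ltin|leni] := ltnP i n; first by rewrite IHn.
  by rewrite bin_small ?mulr0 //; have := ltn_ord i; lia.
exact: addIr.
Qed.

Lemma size_hstar_mul D E f g : (size (hstar_mul D E f g) <= (D + E).+1)%N.
Proof.
apply/(leq_trans (size_sum _ _ _))/bigmax_leqP => i _.
apply/(leq_trans (size_sum _ _ _))/bigmax_leqP => j _.
apply/(leq_trans (size_scale_leq _ _))/(leq_trans (size_sum _ _ _)).
apply/bigmax_leqP => k _; apply/(leq_trans (size_scale_leq _ _)).
by rewrite size_polyXn; have := ltn_ord i; lia.
Qed.

Lemma hstar_mulC D E f g : hstar_mul D E f g = hstar_mul E D g f.
Proof.
apply: (@ehr_inj (D + E)) => [||n]; rewrite ?size_hstar_mul //.
  by rewrite addnC size_hstar_mul.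
by rewrite ehr_mul addnC ehr_mul mulrC.
Qed.

Lemma hstar_mulDl D E f1 f2 g :
  hstar_mul D E (f1 + f2) g = hstar_mul D E f1 g + hstar_mul D E f2 g.
Proof.
rewrite -big_split; apply: eq_bigr => i _ /=; rewrite -big_split.
by apply: eq_bigr => j _; rewrite coefD mulrDl scalerDl.
Qed.

Lemma hstar_mulZl D E a f g :
  hstar_mul D E (a *: f) g = a *: hstar_mul D E f g.
Proof.
rewrite scaler_sumr; apply: eq_bigr => i _; rewrite scaler_sumr.
by apply: eq_bigr => j _; rewrite coefZ scalerA mulrA.
Qed.

Lemma ehrX D h n : (size h <= D)%N ->
  ehr D ('X * h) n = if n is m.+1 then ehr D h m else 0.
Proof.
move=> sh; rewrite /ehr big_ord_recl coefXM eqxx mul0r add0r.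
case: n => [|m].
  by apply: big1 => i _; rewrite bin_small ?mulr0 //=; have := ltn_ord i;
    rewrite /bump; lia.
rewrite big_ord_recr /= [X in _ + X]mulrC nth_default // mulr0 addr0.
by apply: eq_bigr => i _; rewrite coefXM.
Qed.

(** Multiplying both factors by X delays both series by one term, hence also their termwise product.
    This identifies the far edge of the sector of a product. *)
Lemma hstar_mulXX D E f g : (size f <= D)%N -> (size g <= E)%N ->
  hstar_mul D E ('X * f) ('X * g) = 'X * hstar_mul D E f g
  /\ (size (hstar_mul D E f g) <= D + E)%N.
Proof.
move=> sf sg.
have lastf : f`_D = 0 by apply: nth_default.
have lastg : g`_E = 0 by apply: nth_default.
split; last first.
  apply/(leq_trans (size_sum _ _ _))/bigmax_leqP => i _.
  have [iD|iD] := ltnP i D; last first.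
    rewrite big1 ?size_poly0 // => j _; rewrite nth_default ?mul0r ?scale0r //.
    exact: leq_trans iD.
  apply/(leq_trans (size_sum _ _ _))/bigmax_leqP => j _.
  apply/(leq_trans (size_scale_leq _ _))/(leq_trans (size_sum _ _ _)).
  apply/bigmax_leqP => k _; apply/(leq_trans (size_scale_leq _ _)).
  by rewrite size_polyXn; lia.
rewrite /hstar_mul big_ord_recl [X in X + _]big1 ?add0r; last first.
  by move=> j _; rewrite coefXM eqxx mul0r scale0r.
rewrite big_ord_recr mulrDr /= [X in _ = _ + 'X * X]big1 ?mulr0 ?addr0;
  last first.
  by move=> j _; rewrite lastf mul0r scale0r.
rewrite mulr_sumr; apply: eq_bigr => i _.
rewrite big_ord_recl [X in X + _](_ : _ = 0) ?add0r;
  last by rewrite [('X * g)`_ _]coefXM mulr0 scale0r.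
rewrite [in RHS]big_ord_recr /= lastg mulr0 scale0r addr0 mulr_sumr.
apply: eq_bigr => j _; rewrite !coefXM /= -scalerAr; congr (_ *: _).
rewrite /hstar_mon mulr_sumr; apply: eq_bigr => k _.
rewrite -scalerAr -exprS; have := ltn_ord k => kE.
by rewrite /bump /=; congr ((_ * _)%:R *: 'X^_);
  [congr 'C(_, _)|congr 'C(_, _)|]; lia.
Qed.

End Ehr.

(** * Stability of the product *)

Lemma coef_XaddC_exp (A : comNzRingType) (c : A) n k :
  (('X + c%:P) ^+ n)`_k = c ^+ (n - k) * 'C(n, k)%:R.
Proof.
rewrite addrC exprDn coef_sum.
have [lekn|ltnk] := leqP k n; last first.
  rewrite bin_small // mulr0 big1 // => i _.
  rewrite coefMn -rmorphXn /= coefCM coefXn.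
  by rewrite (_ : (k == i) = false) ?mulr0 ?mul0rn //; have := ltn_ord i; lia.
rewrite (bigD1 (Ordinal (lekn : (k < n.+1)%N))) //= big1 ?addr0.
  by rewrite coefMn -rmorphXn /= coefCM coefXn eqxx mulr1 mulr_natr.
move=> i; rewrite -val_eqE /= => ik.
by rewrite coefMn -rmorphXn /= coefCM coefXn eq_sym (negPf ik) mulr0 mul0rn.
Qed.

Section Stability.
Variable R : rcfType.
Local Notation C := R[i].
Local Notation Re := complex.Re.
Local Notation Im := complex.Im.
Implicit Types (z w u v c : C) (p q f g : {poly C}).

Lemma ImcD u v : Im (u + v) = Im u + Im v. Proof. by case: u v => [a b] [c d].
Qed.
Lemma ImcN u : Im (- u) = - Im u. Proof. by case: u. Qed.
Lemma ImcV u : Im u^-1 = - Im u / (Re u ^+ 2 + Im u ^+ 2).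
Proof. by case: u => a b /=; rewrite mulNr. Qed.
Lemma Imc_neq0 u : Im u != 0 -> u != 0.
Proof. by apply: contraNneq => ->. Qed.

Lemma ImcV_gt0 u : Im u < 0 -> 0 < Im u^-1.
Proof.
move=> u0; rewrite ImcV divr_gt0 ?oppr_gt0 //.
by rewrite ltr_wpDl ?sqr_ge0 // exprn_even_gt0 //= lt_eqF.
Qed.

(** [S] is the sum of the 1 / ((w - r) c), the logarithmic derivative after rotation by c. Each (w -
    r) c lies in the lower half-plane, so each inverse lies in the upper one. *)
Lemma log_deriv_half_plane c w (rs : seq C) :
  Im (w * c) <= 0 -> all (fun r => 0 < Im (r * c)) rs ->
  exists S, (\prod_(r <- rs) ('X - r%:P))^`().[w]
     = (\prod_(r <- rs) ('X - r%:P)).[w] * S * c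
   /\ (if rs is [::] then S = 0 else 0 < Im S).
Proof.
move=> w0; elim: rs => [|r rs IH] /=.
  by exists 0; split=> //; rewrite !big_nil derivE horner0 mulr0 mul0r.
move=> /andP[r0 /IH [S [eqS S0]]]; rewrite !big_cons.
have d0 : Im ((w - r) * c) < 0.
  by rewrite mulrBl ImcD ImcN subr_lt0; exact: le_lt_trans w0 r0.
have dn0 : (w - r) * c != 0 by apply: Imc_neq0; rewrite lt_eqF.
exists (((w - r) * c)^-1 + S); split.
  rewrite derivM hornerD !hornerM eqS derivXsubC hornerC hornerXsubC mul1r.
  have c0 : c != 0 by apply: contraNneq dn0 => ->; rewrite mulr0.
  have r1 : w - r != 0 by apply: contraNneq dn0 => ->; rewrite mul0r.
  by field; rewrite c0.
rewrite ImcD; have := ImcV_gt0 d0; case: rs S0 {IH eqS} => [-> /=|? ? ];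
  last by lra.
by rewrite addr0.
Qed.

Definition free_below c p := forall w, Im (w * c) <= 0 -> p.[w] != 0.

(* Gauss-Lucas *)
Lemma deriv_free_below c p : (1 < size p)%N ->
  free_below c p -> free_below c p^`().
Proof.
move=> sp pc w w0; have [rs def_p] := closed_field_poly_normal p.
have p0 : p != 0 by rewrite -size_poly_gt0 ltnW.
have l0 : lead_coef p != 0 by rewrite lead_coef_eq0.
have rs_gt0 : all (fun r => 0 < Im (r * c)) rs.
  apply/allP => r rrs; rewrite ltNge; apply/negP => /pc /negP; apply.
  by rewrite def_p hornerZ mulf_eq0 -/(root _ _) root_prod_XsubC rrs orbT.
have [S [eqS S0]] := log_deriv_half_plane w0 rs_gt0.
have := pc w w0; rewrite def_p derivZ !hornerZ eqS !mulf_eq0 !negb_or l0 /= =>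
  -> /=.
have c0 : c != 0.
  apply: contraTneq sp => c0; rewrite def_p;
    case: rs rs_gt0 {def_p eqS S0} => [|r rs] /=.
    by rewrite big_nil alg_polyC size_polyC l0.
  by rewrite c0 mulr0 ltxx.
rewrite c0 andbT; case: rs S0 {eqS rs_gt0} def_p => [_ def_p|r rs S0 _];
  last first.
  by apply: Imc_neq0; rewrite gt_eqF.
by move: sp; rewrite def_p big_nil alg_polyC size_polyC l0.
Qed.

(** Up to a factorial, the coefficient is the value at 0 of the k-th derivative, and 0 belongs to
    the zero-free closed half-plane. *)
Lemma coef_free_below c p k : free_below c p -> (k < size p)%N -> p`_k != 0.
Proof.
elim: k p => [|k IHk] p pc kp.
  by rewrite -horner_coef0; apply: pc; rewrite mul0r.
have sp : (1 < size p)%N by lia.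
have /IHk := deriv_free_below sp pc.
rewrite coef_deriv -mulr_natr mulf_eq0 pnatr_eq0 orbF; apply.
rewrite ltnNge; apply/negP => /leq_sizeP/(_ (size p).-2).
rewrite coef_deriv -mulr_natr prednK; last by lia.
have ks : (k <= (size p).-2)%N by lia.
move=> /(_ ks)/eqP; rewrite mulf_eq0 pnatr_eq0 -lead_coefE lead_coef_eq0.
by rewrite -size_poly_eq0; case: (size p) sp => [|[|n]].
Qed.

(** * Moebius substitutions and the zeros of Wagner's product *)

Definition half_free f := forall z, 0 < Im z -> f.[z] != 0.
Definition nonneg_coefs f := forall i, 0 <= f`_i.

Let blend_algebra (a b c d : C) : d != 0 -> a * (b * c) = c * d * (a * (b / d)).
Proof. by move=> d0; field. Qed.

(** The homogenised Moebius substitution (X + 1)^D f((X + a) / (X + 1)). *)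
Definition blend D a f : {poly C} :=
  \sum_(i < D.+1) f`_i *: (('X + a%:P) ^+ i * ('X + 1%:P) ^+ (D - i)).

(** The polynomial (X + z)^E g(z (X + 1) / (X + z)); the argument of g is z divided by the argument
    of f in [blend D z f]. *)
Definition coblend E z g : {poly C} :=
  \sum_(j < E.+1) (g`_j * z ^+ j) *: (('X + z%:P) ^+ (E - j) * ('X + 1%:P) ^+
    j).

(** For monomials of degrees i and j the product on the right is z^j (X + z)^(E+i-j) (X +
    1)^(D+j-i), whose coefficient of index E is the value of [hstar_mon D E i j] at z. *)
Lemma horner_hstar_mul D E f g z :
  (hstar_mul D E f g).[z] = (blend D z f * coblend E z g)`_E.
Proof.
rewrite /blend mulr_suml coef_sum horner_sum; apply: eq_bigr => i _.
rewrite /coblend mulr_sumr coef_sum horner_sum; apply: eq_bigr => j _.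
rewrite -scalerAl -scalerAr scalerA coefZ hornerZ mulrA -[RHS]mulrA;
  congr (_ * _).
have := ltn_ord i; have := ltn_ord j => jE iD.
have -> : ('X + z%:P) ^+ i * ('X + 1%:P) ^+ (D - i) *
   (('X + z%:P) ^+ (E - j) * ('X + 1%:P) ^+ j)
   = ('X + z%:P) ^+ (E + i - j) * ('X + 1%:P) ^+ (D + j - i).
  have -> : (E + i - j = i + (E - j))%N by lia.
  have -> : (D + j - i = D - i + j)%N by lia.
  by rewrite !exprD; ring.
rewrite coefM mulr_sumr horner_sum; apply: eq_bigr => k _; have kE := ltn_ord k.
rewrite !coef_XaddC_exp expr1n mul1r hornerZ hornerXn natrM.
have [lekP|ltPk] := leqP k (E + i - j);
  last by rewrite bin_small // !(mul0r, mulr0).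
have -> : (E + i - k = j + (E + i - j - k))%N by lia.
by rewrite exprD; ring.
Qed.

Lemma horner_XaddC_exp (a w : C) n : (('X + a%:P) ^+ n).[w] = (w + a) ^+ n.
Proof. by rewrite horner_exp hornerD hornerX hornerC. Qed.

Lemma horner_blend D a f w : (size f <= D.+1)%N -> w + 1 != 0 ->
  (blend D a f).[w] = (w + 1) ^+ D * f.[(w + a) / (w + 1)].
Proof.
move=> sf w1; rewrite (horner_coef_wide _ sf) mulr_sumr horner_sum.
apply: eq_bigr => i _; have iD : (i <= D)%N by rewrite -ltnS.
rewrite hornerZ hornerM !horner_XaddC_exp expr_div_n.
have -> : (w + 1) ^+ D = (w + 1) ^+ (D - i) * (w + 1) ^+ i by rewrite -exprD
  subnK.
by apply: blend_algebra; rewrite expf_neq0.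
Qed.

Lemma horner_coblend E z g w : (size g <= E.+1)%N -> w + z != 0 ->
  (coblend E z g).[w] = (w + z) ^+ E * g.[z * (w + 1) / (w + z)].
Proof.
move=> sg wz; rewrite (horner_coef_wide _ sg) mulr_sumr horner_sum.
apply: eq_bigr => j _; have jE : (j <= E)%N by rewrite -ltnS.
rewrite hornerZ hornerM !horner_XaddC_exp expr_div_n exprMn.
have -> : (w + z) ^+ E = (w + z) ^+ (E - j) * (w + z) ^+ j by rewrite -exprD
  subnK.
rewrite -[LHS]mulrA [z ^+ j * (_ * _)]mulrCA.
rewrite [in LHS](mulrC ((w + z) ^+ (E - j))).
by apply: blend_algebra; rewrite expf_neq0.
Qed.

Lemma size_XaddC_expM (a b : C) m n :
  (size (('X + a%:P) ^+ m * ('X + b%:P) ^+ n)) = (m + n).+1.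
Proof.
have monX (c : C) k : ('X + c%:P) ^+ k \is monic.
  by apply: monic_exp; rewrite -[c]opprK polyCN monicXsubC.
have sX (c : C) k : size (('X + c%:P) ^+ k) = k.+1.
  by rewrite -[c]opprK polyCN size_exp_XsubC.
rewrite size_monicM ?monX //; last by rewrite monic_neq0 ?monX.
by rewrite !sX /=; lia.
Qed.

Lemma coef_XaddC_expM (a b : C) m n N : (m + n = N)%N ->
  (('X + a%:P) ^+ m * ('X + b%:P) ^+ n)`_N = 1.
Proof.
move=> <-.
have mon : ('X + a%:P) ^+ m * ('X + b%:P) ^+ n \is monic.
  by rewrite -[a]opprK -[b]opprK (polyCN (- a)) (polyCN (- b)) rpredM ?rpredX
    ?monicXsubC.
by have := monicP mon; rewrite lead_coefE size_XaddC_expM.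
Qed.

(** All summands are multiples of monic polynomials of degree D, so the coefficient of index D is
    f(1). *)
Lemma size_blend D a f : (size f <= D.+1)%N -> f.[1] != 0 ->
  size (blend D a f) = D.+1.
Proof.
move=> sf f1; apply/eqP; rewrite eqn_leq; apply/andP; split.
  apply/(leq_trans (size_sum _ _ _))/bigmax_leqP => i _.
  apply/(leq_trans (size_scale_leq _ _)); rewrite size_XaddC_expM.
  by have := ltn_ord i; lia.
rewrite ltnNge; apply: contraNN f1 => /leq_sizeP/(_ D (leqnn _)) bD.
rewrite -bD (horner_coef_wide _ sf) coef_sum; apply/eqP/eq_bigr => i _.
have iD : (i <= D)%N by rewrite -ltnS.
by rewrite expr1n coefZ coef_XaddC_expM ?subnKC.
Qed.

Lemma size_coblend E z g : (size g <= E.+1)%N -> g.[z] != 0 ->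
  size (coblend E z g) = E.+1.
Proof.
move=> sg gz; apply/eqP; rewrite eqn_leq; apply/andP; split.
  apply/(leq_trans (size_sum _ _ _))/bigmax_leqP => i _.
  apply/(leq_trans (size_scale_leq _ _)); rewrite size_XaddC_expM.
  by have := ltn_ord i; lia.
rewrite ltnNge; apply: contraNN gz => /leq_sizeP/(_ E (leqnn _)) bE.
rewrite -bE (horner_coef_wide _ sg) coef_sum; apply/eqP/eq_bigr => j _.
have jE : (j <= E)%N by rewrite -ltnS.
by rewrite coefZ coef_XaddC_expM ?subnK ?mulr1.
Qed.

Lemma horner_gt0 f (x : R) : nonneg_coefs f -> f != 0 -> 0 < x ->
  0 < f.[x%:C%C].
Proof.
move=> f0 fn0 x0; rewrite horner_coef.
have xC : 0 < x%:C%C :> C by rewrite ltcR.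
have ks : ((size f).-1 < size f)%N by rewrite prednK // size_poly_gt0.
rewrite (bigD1 (Ordinal ks)) //= ltr_wpDr //.
  by apply: sumr_ge0 => i _; rewrite mulr_ge0 ?exprn_ge0 // ltW.
rewrite mulr_gt0 ?exprn_gt0 // lt_neqAle f0 andbT eq_sym.
by rewrite -lead_coefE lead_coef_eq0.
Qed.

(** The coefficients are real, so conjugation carries the zero-free upper half-plane to the lower
    one; nonnegativity excludes positive zeros. *)
Lemma root_nonneg f w : nonneg_coefs f -> half_free f ->
  root f w -> Im w = 0 /\ Re w <= 0.
Proof.
move=> f0 fH rw.
have fn0 : f != 0.
  by apply: contraNneq (fH 'i%C ltr01) => ->; rewrite horner0.
have Iw : Im w = 0.
  have [Iw|Iw|//] := ltgtP (Im w) 0; last by case/negP: (fH w Iw).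
  have : root f (w^*)%C.
    rewrite -complex_root_conj (_ : map_poly _ f = f) //.
    apply/polyP => i; rewrite coef_map /=.
    have := f0 i; case: (f`_i) => a b; rewrite lecE /= => /andP[/eqP-> _].
    by rewrite oppr0.
  have : 0 < Im (w^*)%C by case: w Iw {rw} => a b /=; lra.
  by move=> /fH /negPf; rewrite -[_ == 0]/(root _ _) => ->.
split=> //; rewrite leNgt; apply/negP => Rw.
have := horner_gt0 f0 fn0 Rw.
have -> : (Re w)%:C%C = w by case: w Iw {rw Rw} => a b /= ->.
by rewrite (eqP rw) ltxx.
Qed.

Lemma Imc_div u v : Im (u / v) = (Im u * Re v - Re u * Im v) / (Re v ^+ 2 + Im
  v ^+ 2).
Proof. by case: u v => [a b] [c d] /=; ring. Qed.

Lemma norm2_gt0 u : u != 0 -> 0 < Re u ^+ 2 + Im u ^+ 2.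
Proof.
case: u => a b; rewrite eq_complex /= negb_and => /orP[h|h].
  by rewrite ltr_wpDr ?sqr_ge0 // exprn_even_gt0.
by rewrite ltr_wpDl ?sqr_ge0 // exprn_even_gt0.
Qed.

(* The zeros of [blend D z f * coblend E z g], a polynomial in
   w = (zeta - z) / (1 - zeta), correspond to zeta with f(zeta) = 0 or
   g(z / zeta) = 0; none of these zeta is in the upper half-plane, which is a
   half-plane containing 0 in the coordinate w.  By Gauss-Lucas all the
   coefficients of the product are then nonzero. *)
Lemma hstar_mul_neq0 D E f g z : 0 < Im z ->
  (size f <= D.+1)%N -> half_free f -> f.[1] != 0 ->
  (size g <= E.+1)%N -> half_free g -> nonneg_coefs g ->
  (hstar_mul D E f g).[z] != 0.
Proof.
move=> z0 sf fH f1 sg gH g0; rewrite horner_hstar_mul.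
have sF := size_blend z sf f1; have sG := size_coblend sg (gH z z0).
(* For zeta = (w + z) / (w + 1), Im zeta |w + 1|^2 = Im z - Im (w c) with c the conjugate of z - 1.
   Hence Im zeta > 0 wherever Im (w c) <= 0. *)
apply: (@coef_free_below ((z - 1)^*)%C); last first.
  have F0 : blend D z f != 0 by rewrite -size_poly_gt0 sF.
  have G0 : coblend E z g != 0 by rewrite -size_poly_gt0 sG.
  by rewrite size_mul // sF sG; lia.
move=> w w0.
have w1 : w + 1 != 0.
  apply: contraTneq w0 => /eqP; rewrite addr_eq0 => /eqP ->.
  by rewrite -ltNge; case: (z) z0 => a b /=; lra.
have wz : w + z != 0.
  apply: contraTneq w0 => /eqP; rewrite addr_eq0 => /eqP ->.
  by rewrite -ltNge; case: (z) z0 => a b /=; nra.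
have zeta0 : 0 < Im ((w + z) / (w + 1)).
  rewrite Imc_div divr_gt0 ?norm2_gt0 //.
  by move: z0 w0 {w1 wz}; case: (z) (w) => [a b] [c d] /=; nra.
rewrite hornerM mulf_neq0 //.
  by rewrite horner_blend // mulf_neq0 ?expf_neq0 // fH.
rewrite horner_coblend // mulf_neq0 ?expf_neq0 //.
(* If z / zeta were a zero of g it would be real and nonpositive, so z and zeta could not both lie
   in the upper half-plane. The rest checks this in coordinates. *)
apply/negP => /(root_nonneg g0 gH) [].
set zeta := (w + z) / (w + 1) in zeta0.
have -> : z * (w + 1) / (w + z) = z / zeta by rewrite /zeta invf_div mulrA.
have zn0 : zeta != 0 by apply: Imc_neq0; rewrite gt_eqF.
have := norm2_gt0 zn0.
move: (zeta) zeta0 z0 => [a b] /=; case: (z) => [x y] /= b0 y0 n0.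
move=> e1 e2.
have {}e1 : y * a = x * b.
  move: e1 => /(congr1 (fun t => t * (a ^+ 2 + b ^+ 2))).
  rewrite mul0r => e1; apply/eqP; rewrite -subr_eq0 -e1; apply/eqP; field.
  by rewrite gt_eqF.
have {}e2 : x * a + y * b <= 0.
  have : (x * (a / (a ^+ 2 + b ^+ 2)) - y * - (b / (a ^+ 2 + b ^+ 2))) * (a ^+
    2 + b ^+ 2) <= 0.
    by rewrite pmulr_lle0.
  by congr (_ <= 0); field; rewrite gt_eqF.
have : 0 < y * (a ^+ 2 + b ^+ 2) by rewrite mulr_gt0.
have : b * (x * a + y * b) <= 0 by rewrite pmulr_rle0.
have -> : b * (x * a + y * b) = a * (x * b) + y * b ^+ 2 by ring.
rewrite -e1; nra.
Qed.

End Stability.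

(** * Sectors in the complex plane *)

Section Plane.
Variable R : rcfType.
Local Notation C := R[i].
Local Notation Re := complex.Re.
Local Notation Im := complex.Im.
Implicit Types (z w u v m p : C).

(** The imaginary part of v times the conjugate of u; its sign is that of the sine of the angle from
    u to v. *)
Definition cross u v : R := Re u * Im v - Im u * Re v.

(* The argument of v / u, taken in ]- pi, pi[, is nonnegative. *)
Definition ahead u v := forall w, 0 < Im w \/ 0 <= w -> v + w * u != 0.

Definition cone u v m := exists a b : R,
  [/\ 0 <= a, 0 <= b & m = a%:C%C * u + b%:C%C * v].

Lemma cross0 v : cross 0 v = 0. Proof. by rewrite /cross !mul0r subr0. Qed.
Lemma crossr0 v : cross v 0 = 0. Proof. by rewrite /cross !mulr0 subr0. Qed.
Lemma crossDl u v w : cross (u + v) w = cross u w + cross v w.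
Proof. by case: u v w => [a b] [c d] [e f]; rewrite /cross /=; ring. Qed.
Lemma crossDr u v w : cross w (u + v) = cross w u + cross w v.
Proof. by case: u v w => [a b] [c d] [e f]; rewrite /cross /=; ring. Qed.
Lemma crossvv v : cross v v = 0. Proof. by rewrite /cross; ring. Qed.
Lemma crossC u v : cross u v = - cross v u. Proof. by rewrite /cross; ring. Qed.
Lemma cross_mulz z v : cross v (z * v) = Im z * (Re v ^+ 2 + Im v ^+ 2).
Proof. by case: z v => [a b] [c d]; rewrite /cross /=; ring. Qed.
Lemma cross_mul2 z u v : cross (z * u) (z * v) =
  (Re z ^+ 2 + Im z ^+ 2) * cross u v.
Proof. by case: z u v => [a b] [c d] [e f]; rewrite /cross /=; ring. Qed.

Lemma cross_sum_ge0 (m1 n1 m2 n2 : nat) (u v : nat -> C) :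
  (forall j l, (m1 <= j < n1)%N -> (m2 <= l < n2)%N ->
    0 <= cross (u j) (v l)) ->
  0 <= cross (\sum_(m1 <= j < n1) u j) (\sum_(m2 <= l < n2) v l).
Proof.
move=> uv.
rewrite (big_morph (cross ^~ _) (fun x y => crossDl x y _) (cross0 _)) big_nat.
apply: sumr_ge0 => j jP.
rewrite (big_morph (cross _) (fun x y => crossDr x y _) (crossr0 _)) big_nat.
by apply: sumr_ge0 => l lP; apply: uv.
Qed.

Lemma ahead_neq0 u v : ahead u v -> v != 0.
Proof. by move=> /(_ 0 (or_intror (lexx _))); rewrite mul0r addr0. Qed.

Lemma ahead_cross u v : u != 0 -> ahead u v -> 0 <= cross u v.
Proof.
move=> u0 uv; rewrite leNgt; apply/negP => cr0.
have := uv (- (v / u)); rewrite mulNr divfK // subrr eqxx => h.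
suff : false by []; apply: h; left; rewrite ImcN Imc_div oppr_gt0.
rewrite ltr_pdivrMr ?norm2_gt0 // mul0r.
by move: cr0; rewrite /cross mulrC [Im u * _]mulrC; lra.
Qed.

Lemma cross_eq0 u v : u != 0 -> cross u v = 0 -> exists a : R, v = a%:C%C * u.
Proof.
move=> u0 cr0; exists ((Re u * Re v + Im u * Im v) / (Re u ^+ 2 + Im u ^+ 2)).
have n0 := norm2_gt0 u0.
move: n0 cr0 {u0}; case: u v => [a b] [c d]; rewrite /cross /= => n0 cr0.
apply/eqP; rewrite eq_complex /=; apply/andP; split; apply/eqP.
  transitivity (((a * c + b * d) * a - b * (a * d - b * c)) / (a ^+ 2 + b ^+
    2)).
    by field; rewrite gt_eqF.
  by rewrite cr0; field; rewrite gt_eqF.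
transitivity (((a * c + b * d) * b + a * (a * d - b * c)) / (a ^+ 2 + b ^+ 2)).
  by field; rewrite gt_eqF.
by rewrite cr0; field; rewrite gt_eqF.
Qed.

Lemma ahead_parallel u v : u != 0 -> ahead u v -> cross u v = 0 ->
  exists2 a : R, 0 < a & v = a%:C%C * u.
Proof.
move=> u0 uv /(cross_eq0 u0) [a def_v]; exists a => //.
rewrite ltNge; apply/negP => a0.
have := uv (- a%:C%C); rewrite def_v mulNr subrr eqxx => h.
by suff : false by []; apply: h; right; rewrite oppr_ge0 lecR.
Qed.

(* Three steps of angle less than pi that fit together cannot wind around
   the origin. *)
Lemma ahead_cone u m v : u != 0 -> ahead u m -> ahead m v -> ahead u v ->
  cone u v m.
Proof.
move=> u0 um mv uv; have m0 := ahead_neq0 um.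
have [c1 c2 c3] := And3 (ahead_cross u0 um) (ahead_cross m0 mv) (ahead_cross u0
  uv).
have [uv0|uvn0] := eqVneq (cross u v) 0.
  have [a a0 def_v] := ahead_parallel u0 uv uv0.
  have um0 : cross u m = 0.
    apply/eqP; rewrite eq_le c1 andbT; move: c2.
    have -> : cross m v = - (a * cross u m).
      by rewrite def_v; case: (u) (m) => [x y] [x' y']; rewrite /cross /=; ring.
    by rewrite oppr_ge0 pmulr_rle0.
  have [b b0 def_m] := ahead_parallel u0 um um0.
  by exists b, 0; split; rewrite ?(ltW b0) // mul0r addr0.
have uvp : 0 < cross u v by rewrite lt_neqAle eq_sym uvn0.
exists (cross m v / cross u v), (cross u m / cross u v); split.
- by rewrite divr_ge0.
- by rewrite divr_ge0.
move: uvn0 {uvp c1 c2 c3 uv mv um m0 u0}.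
case: u m v => [a b] [c d] [e f]; rewrite /cross /= => n0.
by apply/eqP; rewrite eq_complex /=; apply/andP; split; apply/eqP; field.
Qed.

Lemma cone_trans p r u v m : cone p r u -> cone p r v -> cone u v m ->
  cone p r m.
Proof.
move=> [a1 [b1 [a10 b10 ->]]] [a2 [b2 [a20 b20 ->]]] [a [b [a0 b0 ->]]].
exists (a * a1 + b * a2), (a * b1 + b * b2).
split; rewrite ?addr_ge0 ?mulr_ge0 //.
by rewrite !rmorphD !rmorphM /=; ring.
Qed.

Lemma cone_left p r : cone p r p.
Proof. by exists 1, 0; rewrite ler01 lexx mul1r mul0r addr0. Qed.
Lemma cone_right p r : cone p r r.
Proof. by exists 0, 1; rewrite ler01 lexx mul1r mul0r add0r. Qed.

Section Sector.
Variables (z p : C).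
Hypotheses (z0 : 0 < Im z) (p0 : p != 0).
Local Notation sector := (cone p (z * p)).

Lemma cross_coord (a b a' b' : R) :
  cross (a%:C%C * p + b%:C%C * (z * p)) (a'%:C%C * p + b'%:C%C * (z * p))
  = (a * b' - a' * b) * (Im z * (Re p ^+ 2 + Im p ^+ 2)).
Proof. by case: (z) (p) => [x y] [c d]; rewrite /cross /=; ring. Qed.

Let area_gt0 : 0 < Im z * (Re p ^+ 2 + Im p ^+ 2).
Proof. by rewrite mulr_gt0 ?norm2_gt0. Qed.

Lemma sectorP m : 0 <= cross p m -> 0 <= cross m (z * p) -> sector m.
Proof.
move=> c1 c2; exists (cross m (z * p) / (Im z * (Re p ^+ 2 + Im p ^+ 2))).
exists (cross p m / (Im z * (Re p ^+ 2 + Im p ^+ 2))).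
split; rewrite ?(divr_ge0 _ (ltW area_gt0)) //.
move: (norm2_gt0 p0) z0 {c1 c2}; case: (z) (p) m => [x y] [c d] [e f].
rewrite /cross /= => n0 y0.
by apply/eqP; rewrite eq_complex /=; apply/andP; split; apply/eqP; field;
  rewrite !gt_eqF.
Qed.

Lemma sector_cross m : sector m -> 0 <= cross p m.
Proof.
move=> [a [b [a0 b0 ->]]].
have -> : cross p (a%:C%C * p + b%:C%C * (z * p))
  = b * (Im z * (Re p ^+ 2 + Im p ^+ 2)).
  by case: (z) (p) => [x y] [c d]; rewrite /cross /=; ring.
by rewrite mulr_ge0 // ltW.
Qed.

(** A nonnegative cross product excludes v = - w u with Im w > 0. For w >= 0 it is excluded because
    the sector is a pointed cone, p and z p being independent over the reals. *)
Lemma sector_ahead u v : sector u -> sector v -> v != 0 -> 0 <= cross u v ->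
  ahead u v.
Proof.
move=> [a [b [a0 b0 def_u]]] [a' [b' [a0' b0' def_v]]] v0 uv w [w0|w0].
  apply: contraTneq uv => /eqP; rewrite addr_eq0 => /eqP def_v'.
  have u0 : u != 0 by apply: contraNneq v0 => u0; rewrite def_v' u0 mulr0 oppr0.
  rewrite -ltNge def_v' -mulNr cross_mulz ImcN mulNr oppr_lt0.
  by rewrite mulr_gt0 ?norm2_gt0.
have [r def_w] : exists r : R, w = r%:C%C.
  by exists (Re w); apply/esym/RRe_real/ger0_real.
move: w0; rewrite {w}def_w ler0c => r0.
apply: contra_neqN v0 => /eqP; rewrite {1}def_v def_u => e.
have {}e : (a' + r * a)%:C%C + (b' + r * b)%:C%C * z = 0.
  apply: (mulIf p0); rewrite mul0r -[RHS]e !rmorphD !rmorphM /=; ring.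
move: e; case: (z) z0 => x y /= y0 /eqP;
  rewrite eq_complex /= => /andP[/eqP e1 /eqP e2].
have b'0 : b' + r * b = 0.
  apply: (mulIf (lt0r_neq0 y0)); rewrite mul0r -[RHS]e2; ring.
have rb0 : 0 <= r * b by rewrite mulr_ge0.
have ra0 : 0 <= r * a by rewrite mulr_ge0.
have a'0 : a' + r * a = 0 by move: e1; rewrite b'0 !mul0r; lra.
have b'E : b' = 0 by lra.
have a'E : a' = 0 by lra.
by rewrite def_v b'E a'E !mul0r addr0.
Qed.

(** The sector is narrower than pi, so the sign of [cross] orders its nonzero vectors by
    argument. *)
Lemma sector_cross_trans u v w : sector u -> sector v -> sector w -> v != 0 ->
  0 <= cross u v -> 0 <= cross v w -> 0 <= cross u w.
Proof.
move=> [a [b [a0 b0 ->]]] [a' [b' [a0' b0' ->]]] [a'' [b'' [a0'' b0'' ->]]] v0.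
rewrite !cross_coord !pmulr_lge0 // => h1 h2.
have [a'p|a'n] := ltP 0 a'.
  have := mulr_ge0 a0'' h1; have := mulr_ge0 a0 h2 => *.
  rewrite -(pmulr_rge0 _ a'p); nra.
have e : a' = 0 by lra.
have b'p : 0 < b'.
  rewrite lt_neqAle b0' andbT eq_sym; apply: contraNneq v0 => ->.
  by rewrite e !mul0r addr0.
have := mulr_ge0 b0 h2; have := mulr_ge0 b0'' h1; rewrite e => *.
rewrite -(pmulr_rge0 _ b'p); nra.
Qed.

(** In terms of arguments, arg u <= arg v <= arg (z p) <= arg (z u), and the step from v to z u is
    at most arg z < pi. *)
Lemma sector_wrap u v : sector u -> sector v -> 0 <= cross u v ->
  0 <= cross v (z * u).
Proof.
move=> [a [b [a0 b0 ->]]] [a' [b' [a0' b0' ->]]].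
rewrite cross_coord pmulr_lge0 // => h.
have -> : cross (a'%:C%C * p + b'%:C%C * (z * p))
                (z * (a%:C%C * p + b%:C%C * (z * p)))
  = (a' * a + 2 * Re z * (a' * b) + b' * b * (Re z ^+ 2 + Im z ^+ 2))
    * (Im z * (Re p ^+ 2 + Im p ^+ 2)).
  by case: (z) (p) => [x y] [c d]; rewrite /cross /=; ring.
rewrite pmulr_lge0 //.
have h1 : 0 <= b' * b * Im z ^+ 2 by rewrite mulr_ge0 ?sqr_ge0 // mulr_ge0.
suff : 0 <= a' * a + 2 * Re z * (a' * b) + b' * b * Re z ^+ 2 by lra.
have [a0E|a'p] := eqVneq a' 0.
  by rewrite a0E !mul0r mulr0 !add0r mulr_ge0 ?sqr_ge0 // mulr_ge0.
have {}a'p : 0 < a' by rewrite lt_neqAle eq_sym a'p.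
move: h; move: (Re z) => x h.
have [b0E|bp] := eqVneq b 0.
  by rewrite b0E !(mulr0, mul0r) !addr0 mulr_ge0.
have {}bp : 0 < b by rewrite lt_neqAle eq_sym bp.
(* This is the discriminant condition for the quadratic in x; multiplying by its leading coefficient
   b' b completes the square. *)
have h2 : a' * b * (a' * b) <= a' * a * (b' * b).
  have := mulr_ge0 (ltW (mulr_gt0 a'p bp)) h; nra.
have Bp : 0 < b' * b.
  rewrite mulr_gt0 // lt_neqAle b0' andbT eq_sym; apply: contraTneq h => ->.
  by rewrite mulr0 sub0r oppr_ge0 -ltNge mulr_gt0.
rewrite -(pmulr_rge0 _ Bp).
have -> : b' * b * (a' * a + 2 * x * (a' * b) + b' * b * x ^+ 2)
  = a' * a * (b' * b) - a' * b * (a' * b) + (a' * b + b' * b * x) ^+ 2 by ring.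
by rewrite addr_ge0 ?sqr_ge0 // subr_ge0.
Qed.

End Sector.
End Plane.

(** * Families of polynomials with values in a sector *)

Section Families.
Variable R : rcfType.
Local Notation C := R[i].
Local Notation Re := complex.Re.
Local Notation Im := complex.Im.
Implicit Types (z w : C) (f g G K : {poly C}) (h : nat -> {poly C}).

Definition interlace f g := forall z, 0 < Im z -> ahead f.[z] g.[z].

(* Real-rooted with nonpositive zeros: see [root_nonneg]. *)
Definition hurwitz D f := [/\ (size f <= D.+1)%N, nonneg_coefs f & half_free f].

Lemma half_free_neq0 f : half_free f -> f != 0.
Proof. by move=> fH; apply: contraNneq (fH 'i%C ltr01) => ->; rewrite horner0.
Qed.

Lemma hstar_mul_nonneg D E f g :
  nonneg_coefs f -> nonneg_coefs g -> nonneg_coefs (hstar_mul D E f g).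
Proof.
move=> f0 g0 n; rewrite coef_sum sumr_ge0 // => i _.
rewrite coef_sum sumr_ge0 // => j _; rewrite coefZ !mulr_ge0 //.
rewrite coef_sum sumr_ge0 // => k _; rewrite coefZ coefXn.
by rewrite mulr_ge0 ?ler0n.
Qed.

Lemma hurwitz_mul D E f g : hurwitz D f -> hurwitz E g ->
  hurwitz (D + E) (hstar_mul D E f g).
Proof.
move=> [sf f0 fH] [sg g0 gH]; split; first exact: size_hstar_mul.
  exact: hstar_mul_nonneg.
move=> z z0; apply: hstar_mul_neq0 => //; rewrite gt_eqF //.
exact: (@horner_gt0 _ f 1 f0 (half_free_neq0 fH) ltr01).
Qed.

(** Interlacing means that each f2 + w f1, for Im w > 0 or w >= 0, has no zero in the upper
    half-plane. The product is linear in its left factor, and [hstar_mul_neq0] admits complex left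
    factors. *)
Lemma interlace_mull D E f1 f2 g : hurwitz D f1 -> hurwitz D f2 ->
  hurwitz E g ->
  interlace f1 f2 -> interlace (hstar_mul D E f1 g) (hstar_mul D E f2 g).
Proof.
move=> [sf1 f10 f1H] [sf2 f20 f2H] [sg g0 gH] f12 z z0 w w0.
rewrite -hornerZ -hornerD -hstar_mulZl -hstar_mulDl.
apply: hstar_mul_neq0 => //.
- apply/(leq_trans (size_polyD _ _)); rewrite geq_max sf2 /=.
  exact: leq_trans (size_scale_leq _ _) _.
- by move=> x x0; rewrite hornerD hornerZ; apply: f12.
(* It remains that f2 + w f1 does not vanish at 1, where f1 and f2 are both positive. *)
have p1 := @horner_gt0 _ f1 1 f10 (half_free_neq0 f1H) ltr01.
have p2 := @horner_gt0 _ f2 1 f20 (half_free_neq0 f2H) ltr01.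
rewrite hornerD hornerZ; move: p1 p2; rewrite !rmorph1.
case: (f1.[1]) (f2.[1]) => [a1 b1] [a2 b2]; rewrite !ltcE /=.
move=> /andP[/eqP -> p1] /andP[/eqP -> p2].
case: w0 => [|]; case: w => x y; rewrite ?lecE /=.
  by move=> y0; rewrite eq_complex /= negb_and; apply/orP; right;
    rewrite mulr0 !add0r gt_eqF // mulr_gt0.
move=> /andP[/eqP-> x0]; rewrite eq_complex /= negb_and; apply/orP; left.
by rewrite mulr0 subr0 gt_eqF // ltr_pwDl // mulr_ge0 // ltW.
Qed.

Lemma interlace_mulr D E f g1 g2 : hurwitz D f -> hurwitz E g1 ->
  hurwitz E g2 ->
  interlace g1 g2 -> interlace (hstar_mul D E f g1) (hstar_mul D E f g2).
Proof.
move=> Hf H1 H2 g12; rewrite ![hstar_mul D E f _]hstar_mulC.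
exact: interlace_mull.
Qed.

Lemma hurwitzX D G : (size G <= D)%N -> nonneg_coefs G -> half_free G ->
  hurwitz D G /\ hurwitz D ('X * G).
Proof.
move=> sG G0 GH; split; split=> //; first exact: leqW.
- by rewrite mulrC size_mulX ?half_free_neq0.
- by move=> [|i]; rewrite coefXM //= lexx.
- by move=> z z0; rewrite hornerM hornerX mulf_neq0 ?GH // Imc_neq0 // gt_eqF.
Qed.

Lemma interlace_mulX G : half_free G -> interlace G ('X * G).
Proof.
move=> GH z z0; have Gz0 := GH z z0; rewrite hornerM hornerX.
apply: (sector_ahead z0 Gz0); rewrite ?mulf_neq0 //.
- exact: cone_left.
- exact: cone_right.
- by rewrite Imc_neq0 // gt_eqF.
- by rewrite cross_mulz mulr_ge0 ?(ltW z0) // ltW // norm2_gt0.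
Qed.

(** The bound on G means degree less than D, so that X G still has degree at most D. Arguments
    decrease with the index: the chain is G, h_(s-1), ..., h_0, X G. *)
Definition sector_family s D h G :=
  [/\ (size G <= D)%N, nonneg_coefs G, half_free G,
      forall i, (i < s)%N -> hurwitz D (h i)
    & forall z, 0 < Im z ->
        (forall i, (i < s)%N -> cone G.[z] (z * G.[z]) (h i).[z]) /\
        (forall i k, (i <= k)%N -> (k < s)%N ->
          0 <= cross (h k).[z] (h i).[z])].

Section Family.
Variables (s D : nat) (h : nat -> {poly C}) (G : {poly C}).
Hypothesis hG : sector_family s D h G.

Let Gz0 z : 0 < Im z -> G.[z] != 0. Proof.
by case: hG => _ _ GH _ _; apply: GH. Qed.

Lemma family_hurwitzG : hurwitz D G /\ hurwitz D ('X * G).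
Proof. by case: hG => sG G0 GH _ _; apply: hurwitzX. Qed.

Lemma interlaceGh i : (i < s)%N -> interlace G (h i).
Proof.
move=> si z z0; case: hG => _ _ _ hH /(_ z z0) [hs _].
have [_ _ /(_ z z0) hiz] := hH i si.
apply: (sector_ahead z0 (Gz0 z0)) => //; [exact: cone_left|exact: hs|].
by apply: (sector_cross z0 (Gz0 z0)); apply: hs.
Qed.

Lemma interlacehG i : (i < s)%N -> interlace (h i) ('X * G).
Proof.
move=> si z z0; rewrite hornerM hornerX; case: hG => _ _ _ _ /(_ z z0) [hs _].
apply: (sector_ahead z0 (Gz0 z0)); [exact: hs|exact: cone_right| |].
  by rewrite mulf_neq0 ?Gz0 // Imc_neq0 // gt_eqF.
exact: (sector_wrap z0 (Gz0 z0) (cone_left _ _) (hs i si) (sector_cross z0 (Gz0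
  z0) (hs i si))).
Qed.

Lemma interlacehh i k : (i <= k)%N -> (k < s)%N -> interlace (h k) (h i).
Proof.
move=> ik ks z z0; case: hG => _ _ _ hH /(_ z z0) [hs hc].
have si := leq_ltn_trans ik ks; have [_ _ /(_ z z0) hiz] := hH i si.
apply: (sector_ahead z0 (Gz0 z0)) => //; by [apply: hs|apply: hc].
Qed.

End Family.

(* Each of the three chains G K -> (XG) K -> (XG) (XK), G K -> h K -> (XG) K
   and h K -> h g -> h (XK) has few enough steps for [ahead_cone]; this puts
   h g in the sector between G K and (XG) (XK) = X (G K). *)
Lemma sector_family_mul s D E h (g : nat -> {poly C}) G K :
  sector_family s D h G -> sector_family s E g K ->
  sector_family s (D + E) (fun i =>
    hstar_mul D E (h i) (g i)) (hstar_mul D E G K).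
Proof.
move=> hG gK.
have [HG HXG] := family_hurwitzG hG; have [HK HXK] := family_hurwitzG gK.
have [sG _ GH hH _] := hG; have [sK _ KH gH _] := gK.
have [eXX sGK] := hstar_mulXX sG sK.
have [_ GK0 GKH] := hurwitz_mul HG HK.
split=> // [i si|z z0]; first exact: hurwitz_mul (hH i si) (gH i si).
set p := (hstar_mul D E G K).[z].
have p0 : p != 0 by apply: GKH.
have nz f1 f2 : hurwitz D f1 -> hurwitz E f2 -> (hstar_mul D E f1 f2).[z] != 0.
  by move=> H1 H2; case: (hurwitz_mul H1 H2) => _ _; apply.
have eXXz : (hstar_mul D E ('X * G) ('X * K)).[z] = z * p.
  by rewrite eXX hornerM hornerX.
have q1 := interlace_mull HG HXG HK (interlace_mulX GH) z0.
have q2 := interlace_mulr HXG HK HXK (interlace_mulX KH) z0.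
have q3 := interlace_mulr HG HK HXK (interlace_mulX KH) z0.
have q4 := interlace_mull HG HXG HXK (interlace_mulX GH) z0.
have pz : ahead p (z * p).
  by have := interlace_mulX GKH z0; rewrite hornerM hornerX.
rewrite eXXz in q2 q4; rewrite -/p in q1 q3.
have c1 := ahead_cone p0 q1 q2 pz.
have c2 := ahead_cone p0 q3 q4 pz.
have hK i : (i < s)%N -> cone p (z * p) (hstar_mul D E (h i) K).[z].
  move=> si; have Hi := hH i si.
  have a1 := interlace_mull HG Hi HK (interlaceGh hG si) z0.
  have a2 := interlace_mull Hi HXG HK (interlacehG hG si) z0.
  exact: cone_trans (cone_left _ _) c1 (ahead_cone p0 a1 a2 q1).
have hXK i : (i < s)%N -> cone p (z * p) (hstar_mul D E (h i) ('X * K)).[z].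
  move=> si; have Hi := hH i si.
  have a1 := interlace_mull HG Hi HXK (interlaceGh hG si) z0.
  have a2 := interlace_mull Hi HXG HXK (interlacehG hG si) z0.
  rewrite eXXz in a2.
  exact: cone_trans c2 (cone_right _ _) (ahead_cone (nz _ _ HG HXK) a1 a2 q4).
have hg i k : (i < s)%N -> (k < s)%N ->
  cone p (z * p) (hstar_mul D E (h i) (g k)).[z].
  move=> si sk; have Hi := hH i si; have Hk := gH k sk.
  have a1 := interlace_mulr Hi HK Hk (interlaceGh gK sk) z0.
  have a2 := interlace_mulr Hi Hk HXK (interlacehG gK sk) z0.
  have a3 := interlace_mulr Hi HK HXK (interlace_mulX KH) z0.
  exact: cone_trans (hK i si) (hXK i si) (ahead_cone (nz _ _ Hi HK) a1 a2 a3).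
split=> [i si|i k ik sk]; first exact: hg.
have si := leq_ltn_trans ik sk.
have Hhi := hH i si; have Hhk := hH k sk; have Hgi := gH i si;
  have Hgk := gH k sk.
(* The order is reached through h_i g_k, changing one factor at a time. *)
have b1 := interlace_mull Hhk Hhi Hgk (interlacehh hG ik sk) z0.
have b2 := interlace_mulr Hhi Hgk Hgi (interlacehh gK ik sk) z0.
apply: (sector_cross_trans z0 p0 (hg k k sk sk) (hg i k si sk) (hg i i si si)).
- exact: nz.
- by apply: ahead_cross b1; apply: nz.
- by apply: ahead_cross b2; apply: nz.
Qed.

(** If h_j is the numerator of n |-> W(n s + j), this is the numerator of the sum of W below n s +
    i: residues below i occur in blocks 0 to n, the others only in blocks 0 to n - 1, whence the
    factor X. *)
Definition psum_poly s h i : {poly C} :=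
  \sum_(0 <= j < i) h j + 'X * \sum_(i <= j < s) h j.

Lemma horner_psum_poly s h i z : (psum_poly s h i).[z] =
  \sum_(0 <= j < i) (h j).[z] + z * \sum_(i <= j < s) (h j).[z].
Proof. by rewrite hornerD hornerM hornerX !horner_sum. Qed.

Lemma psum_poly_last s h : psum_poly s h s = \sum_(0 <= j < s) h j.
Proof. by rewrite /psum_poly (@big_geq _ _ _ s s) // mulr0 addr0. Qed.

(** The s + 1 partial sums run from G, the sum of all h_j, at index s, to X G at index 0. The
    hypothesis is an order condition without a bottom element, so that it also covers leaves. *)
Lemma psum_sector_family s D h : (0 < s)%N ->
  (forall i, (i < s)%N -> hurwitz D (h i)) ->
  (forall z, 0 < Im z -> forall i k, (i <= k)%N -> (k < s)%N ->
     0 <= cross (h k).[z] (h i).[z] /\ 0 <= cross (h i).[z] (z * (h k).[z])) ->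
  sector_family s.+1 D.+1 (psum_poly s h) (psum_poly s h s).
Proof.
move=> s0 hH hc.
have sum_size m n : (n <= s)%N -> (size (\sum_(m <= j < n) h j)%R <= D.+1)%N.
  move=> ns; rewrite big_nat;
    apply/(leq_trans (size_sum _ _ _))/bigmax_leqP_seq.
  by move=> j _ /andP[_ jn]; have [] := hH j (leq_trans jn ns).
have sum_nonneg m n k : (n <= s)%N -> 0 <= (\sum_(m <= j < n) h j)`_k.
  move=> ns; rewrite big_nat coef_sum sumr_ge0 // => j /andP[_ jn].
  by have [] := hH j (leq_trans jn ns).
have psum_nonneg i : (i <= s)%N -> nonneg_coefs (psum_poly s h i).
  move=> si k; rewrite coefD coefXM addr_ge0 ?sum_nonneg //.
  by case: k => [|k] //=; rewrite sum_nonneg.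
have psum_free_S i : (i < s)%N -> half_free (psum_poly s h i.+1).
  move=> si z z0; apply: contraTneq isT => B0.
  (* In the cross product with z h_i(z) every summand contributes a nonnegative amount and h_i(z)
     itself a positive one, so the value cannot be 0. *)
  have := crossDl (\sum_(0 <= j < i.+1) (h j).[z]) (z * \sum_(i.+1 <= j < s) (h
    j).[z]) (z * (h i).[z]).
  rewrite -horner_psum_poly B0 cross0 cross_mul2 => e.
  have /(_ z z0) hi0 : half_free (h i) by have [] := hH i si.
  have e1 : 0 <= cross (\sum_(i.+1 <= j < s) (h j).[z]) (\sum_(i <= l < i.+1)
    (h l).[z]).
    apply: cross_sum_ge0 => j l jP lP.
    by case: (hc z z0 l j) => //; lia.
  have e2 : 0 <= cross (\sum_(0 <= j < i) (h j).[z]) (\sum_(i <= l < i.+1) z *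
    (h l).[z]).
    by apply: cross_sum_ge0 => j l jP lP; case: (hc z z0 j l) => //; lia.
  rewrite big_nat1 in e1; rewrite big_nat1 in e2.
  rewrite big_nat_recr //= crossDl cross_mulz in e.
  have e3 : 0 < Im z * (Re (h i).[z] ^+ 2 + Im (h i).[z] ^+ 2) by rewrite
    mulr_gt0 ?norm2_gt0.
  have e4 : 0 <= (Re z ^+ 2 + Im z ^+ 2) * cross (\sum_(i.+1 <= j < s) (h
    j).[z]) (h i).[z].
    exact: mulr_ge0 (addr_ge0 (sqr_ge0 _) (sqr_ge0 _)) e1.
  by exfalso; lra.
have psum_free i : (i <= s)%N -> half_free (psum_poly s h i).
  (* Index 0 gives X times the polynomial of index s, and s is positive. *)
  case: i => [_|i]; last exact: psum_free_S.
  move=> z z0; rewrite horner_psum_poly big_geq // add0r.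
  have := psum_free_S s.-1; rewrite prednK // => /(_ (leqnn _) z z0).
  rewrite psum_poly_last horner_sum => n0.
  by rewrite mulf_neq0 // Imc_neq0 // gt_eqF.
have order z i k : 0 < Im z -> (i <= k)%N -> (k <= s)%N ->
    0 <= cross (psum_poly s h k).[z] (psum_poly s h i).[z].
  move=> z0 ik ks; rewrite !horner_psum_poly.
  (* With block sums a, b, c the claim concerns a + b + z c and a + z (b + c). In the bilinear
     expansion the two terms pairing a with z c cancel, and all others are nonnegative. *)
  rewrite [in X in cross _ X](big_cat_nat (m := i) (n := k)) //=.
  rewrite [in X in cross X _](big_cat_nat (n := i)) //=.
  set a := \sum_(0 <= j < i) _; set b := \sum_(i <= j < k) _;
    set c := \sum_(k <= j < s) _.
  have ba : 0 <= cross b a.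
    by apply: cross_sum_ge0 => j l jP lP; case: (hc z z0 l j) => //; lia.
  have cb : 0 <= cross c b.
    by apply: cross_sum_ge0 => j l jP lP; case: (hc z z0 l j) => //; lia.
  have azb : 0 <= cross a (z * b).
    rewrite mulr_sumr; apply: cross_sum_ge0 => j l jP lP.
    by case: (hc z z0 j l) => //; lia.
  have bzc : 0 <= cross b (z * c).
    rewrite mulr_sumr; apply: cross_sum_ge0 => j l jP lP.
    by case: (hc z z0 j l) => //; lia.
  rewrite mulrDr !(crossDl, crossDr) !crossvv cross_mulz cross_mul2.
  rewrite [cross (z * c) a]crossC.
  have := mulr_ge0 (addr_ge0 (sqr_ge0 (Re z)) (sqr_ge0 (Im z))) cb.
  have : 0 <= Im z * (Re b ^+ 2 + Im b ^+ 2).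
    by rewrite mulr_ge0 ?(ltW z0) // addr_ge0 ?sqr_ge0.
  lra.
have wrap z i : 0 < Im z -> (i <= s)%N ->
    0 <= cross (psum_poly s h i).[z] (z * (psum_poly s h s).[z]).
  move=> z0 si; rewrite psum_poly_last horner_sum horner_psum_poly.
  rewrite [in X in cross _ X](big_cat_nat (n := i)) //=.
  set a := \sum_(0 <= j < i) _; set b := \sum_(i <= j < s) _.
  have ba : 0 <= cross b a.
    by apply: cross_sum_ge0 => j l jP lP; case: (hc z z0 l j) => //; lia.
  have azb : 0 <= cross a (z * b).
    rewrite mulr_sumr; apply: cross_sum_ge0 => j l jP lP.
    by case: (hc z z0 j l) => //; lia.
  rewrite mulrDr !(crossDl, crossDr) !crossvv cross_mulz cross_mul2.
  have := mulr_ge0 (addr_ge0 (sqr_ge0 (Re z)) (sqr_ge0 (Im z))) ba.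
  have : 0 <= Im z * (Re a ^+ 2 + Im a ^+ 2).
    by rewrite mulr_ge0 ?(ltW z0) // addr_ge0 ?sqr_ge0.
  lra.
split=> [|||i si|z z0].
- by rewrite psum_poly_last sum_size.
- exact: psum_nonneg.
- exact: psum_free.
- split; [|exact: psum_nonneg|exact: psum_free].
  apply/(leq_trans (size_polyD _ _)); rewrite geq_max; apply/andP; split.
    exact/leqW/sum_size.
  apply/(leq_trans (size_polyMleq _ _)); rewrite size_polyX.
  by have := sum_size i s (leqnn s); lia.
split=> [i si|i k ik ks]; last exact: order.
by apply: sectorP => //; [exact: psum_free|exact: order|exact: wrap].
Qed.

End Families.

(** * Weights *)

Section PartialSums.
Variable A : comNzRingType.
Implicit Types (h : {poly A}) (W : nat -> A).

Lemma sum_bin_hockey n D i : (i <= D)%N ->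
  (\sum_(0 <= m < n.+1) 'C(m + D - i, D) = 'C(n + D.+1 - i, D.+1))%N.
Proof.
move=> iD; elim: n => [|n IHn].
  rewrite big_nat1 !add0n; case: i iD => [|i] iD; first by rewrite !subn0 !binn.
  by rewrite !bin_small //; lia.
rewrite big_nat_recr //= IHn (_ : (n.+1 + D.+1 - i = (n + D.+1 - i).+1)%N);
  last by lia.
by rewrite binS; congr (_ + 'C(_, _))%N; lia.
Qed.

(** Dividing a series by 1 - t sums its coefficients; on binomials this is the hockey-stick
    identity. *)
Lemma ehr_psum D h n : (size h <= D.+1)%N ->
  ehr D.+1 h n = \sum_(0 <= m < n.+1) ehr D h m.
Proof.
move=> sh; rewrite /ehr big_ord_recr /= nth_default // mul0r addr0.
rewrite exchange_big /=; apply: eq_bigr => i _.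
by rewrite -mulr_sumr -natr_sum sum_bin_hockey // -ltnS.
Qed.

Lemma ehr_psumX D h n : (size h <= D.+1)%N ->
  ehr D.+1 ('X * h) n = \sum_(0 <= m < n) ehr D h m.
Proof.
move=> sh; rewrite ehrX //; case: n => [|n]; first by rewrite big_geq.
exact: ehr_psum.
Qed.

Lemma sum_blocks W s n i :
  \sum_(0 <= j < n * s + i) W j =
  \sum_(0 <= m < n) \sum_(0 <= j < s) W (m * s + j)%N
  + \sum_(0 <= j < i) W (n * s + j)%N.
Proof.
have block a b : \sum_(0 <= j < a + b) W j =
    \sum_(0 <= j < a) W j + \sum_(0 <= j < b) W (a + j)%N.
  rewrite (big_cat_nat (n := a)) ?leq_addr //=; congr (_ + _).
  rewrite -{1}(add0n a) big_addn addKn.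
  by apply: eq_bigr => j _; rewrite addnC.
rewrite block; congr (_ + _); elim: n => [|n IHn]; first by rewrite !big_geq.
by rewrite mulSnr block IHn [RHS]big_nat_recr.
Qed.

End PartialSums.

Section Weights.
Variable R : rcfType.
Local Notation C := R[i].
Local Notation Im := complex.Im.
Implicit Types (W V : nat -> C) (f G : {poly C}) (h : nat -> {poly C}).

Definition interlacing_weight s D W := exists h G, sector_family s D h G /\
  forall n i, (i < s)%N -> W (n * s + i)%N = ehr D (h i) n.

(* The first case is the weight of a leaf, for which no bottom element G of
   degree less than D = 0 exists. *)
Definition good_weight s D W :=
  (D = 0%N /\ W =1 fun=> 1) \/ interlacing_weight s D W.

Lemma good_weight_psum s D W : (0 < s)%N -> good_weight s D W ->
  exists h G, sector_family s.+1 D.+1 h G /\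
    forall n i, (i <= s)%N -> \sum_(0 <= j < n * s + i) W j = ehr D.+1 (h i) n.
Proof.
move=> s0 gW.
(* Both kinds of good weight yield the order condition. For a leaf all h_i are 1, and [cross] of 1
   and z is Im z > 0. *)
have [h [hH hc hW]] : exists h,
  [/\ forall i, (i < s)%N -> hurwitz D (h i),
      forall z, 0 < Im z -> forall i k, (i <= k)%N -> (k < s)%N ->
        0 <= cross (h k).[z] (h i).[z] /\ 0 <= cross (h i).[z] (z * (h k).[z])
    & forall n i, (i < s)%N -> W (n * s + i)%N = ehr D (h i) n].
  case: gW => [[-> W1]|[h [G [[sG G0 GH hH hs] hW]]]].
    exists (fun=> 1); split=> [i _|z z0 i k _ _|n i _].
    - split=> [|k|z z0]; rewrite ?size_poly1 ?hornerC ?oner_eq0 //.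
      by rewrite coef1 ler0n.
    - rewrite hornerC crossvv cross_mulz; split=> //=.
      by rewrite expr1n expr0n addr0 mulr1 ltW.
    - by rewrite W1 /ehr big_ord_recl big_ord0 coef1 bin0 addr0 mulr1.
  exists h; split=> // z z0 i k ik ks; have [hc ho] := hs z z0.
  split; first exact: ho.
  have si := leq_ltn_trans ik ks.
  by apply: (sector_wrap z0 (GH z z0) (hc k ks) (hc i si)); apply: ho.
exists (psum_poly s h), (psum_poly s h s); split.
  exact: psum_sector_family.
have sh i : (i < s)%N -> (size (h i) <= D.+1)%N by move=> /hH [].
move=> n i si; rewrite sum_blocks ehrD ehr_psumX; last first.
  rewrite big_nat; apply/(leq_trans (size_sum _ _ _))/bigmax_leqP_seq.
  by move=> j _ /andP[_ /sh].
rewrite ehr_sum.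
have -> : \sum_(0 <= m < n) ehr D (\sum_(i <= j < s) h j) m
    = \sum_(0 <= m < n) \sum_(i <= j < s) W (m * s + j)%N.
  apply: eq_bigr => m _; rewrite ehr_sum; apply: eq_big_nat => j /andP[_ js].
  by rewrite hW.
have -> : \sum_(0 <= j < i) ehr D.+1 (h j) n =
    \sum_(0 <= m < n) \sum_(0 <= j < i) W (m * s + j)%N
    + \sum_(0 <= j < i) W (n * s + j)%N.
  rewrite [X in _ = X + _]exchange_big -[RHS]big_split;
    apply: eq_big_nat => j /andP[_ ji] /=.
  have js := leq_trans ji si.
  rewrite ehr_psum ?sh // big_nat_recr //= hW //; congr (_ + _).
  by apply: eq_bigr => m _; rewrite hW.
rewrite addrAC -big_split /=; congr (_ + _); apply: eq_bigr => m _.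
by rewrite (big_cat_nat (n := i)).
Qed.

Lemma good_weight_mul s D E W V : good_weight s D W ->
  interlacing_weight s E V ->
  interlacing_weight s (D + E) (fun m => W m * V m).
Proof.
move=> [[-> W1]|[h [G [hG hW]]]] [g [K [gK gV]]].
  by exists g, K; split=> // n i si; rewrite W1 mul1r gV.
exists (fun i => hstar_mul D E (h i) (g i)), (hstar_mul D E G K).
split; first exact: sector_family_mul.
by move=> n i si; rewrite hW // gV // ehr_mul.
Qed.

(* Adding a child of scale s below a parent of scale q: for e = q the sum runs
   over x / s <= y / q, for e = q - 1 over x / s < y / q. *)
Lemma good_weight_child s q e D E W V : (0 < s)%N -> (q.-1 <= e <= q)%N ->
  (0 < q)%N ->
  good_weight s D W -> good_weight q E V ->
  good_weight q (E + D.+1) (fun y =>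
    V y * \sum_(0 <= x < (y * s + e) %/ q) W x).
Proof.
move=> s0 eq q0 /(good_weight_psum s0) [h [G [hG hW]]] gV; right.
apply: (good_weight_mul gV).
(* For y = n q + i the upper limit of the sum is n s + k(i). Since k is monotone with values at most
   s, the h_(k(i)) form a sector family with the same G. *)
pose k i := ((i * s + e) %/ q)%N.
have ks i : (i < q)%N -> (k i <= s)%N.
  move=> iq; rewrite -ltnS ltn_divLR //.
  have : (i.+1 * s <= q * s)%N by rewrite leq_mul2r iq orbT.
  by rewrite mulSn mulSn mulnC; lia.
have kmono i j : (i <= j)%N -> (k i <= k j)%N.
  by move=> ij; rewrite leq_div2r // leq_add2r leq_mul2r ij orbT.
exists (fun i => h (k i)), G; split.
  case: hG => sG G0 GH hH hs; split=> // [i iq|z z0]; first by apply: hH;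
    rewrite ltnS ks.
  have [hc ho] := hs z z0; split=> [i iq|i j ij jq]; first by apply: hc;
    rewrite ltnS ks.
  by apply: ho; rewrite ?ltnS ?ks ?kmono.
move=> n i iq; rewrite -hW ?ks //; congr (\sum_(0 <= x < _) W x).
by rewrite mulnDl -addnA mulnAC divnMDl.
Qed.

Lemma good_weight_root s D W : (0 < s)%N -> good_weight s D W ->
  exists2 f, hurwitz D.+1 f &
    forall n, \sum_(0 <= x < (n * s).+1) W x = ehr D.+1 f n.
Proof.
move=> s0 /(good_weight_psum s0) [h [G [[_ _ _ hH _] hW]]].
(* The sum has n s + 1 terms, so the offset is 1, which is at most s. *)
exists (h 1%N) => [|n]; first by apply: hH; rewrite ltnS.
by rewrite -hW // addn1.
Qed.

End Weights.

(** * Elimination of leaves *)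

Section Tree.
Variables (R : rcfType) (I : finType) (root : I) (par : I -> I) (ht : I -> nat).
Variables (s e : I -> nat).
Hypothesis ht_par : forall u, u != root -> (ht u < ht (par u))%N.
Hypothesis s_gt0 : forall u, (0 < s u)%N.
Hypothesis e_bound : forall u, ((s (par u)).-1 <= e u <= s (par u))%N.
Local Notation C := R[i].
Implicit Types (S : {set I}) (W : I -> nat -> C) (D : I -> nat).

(** The number of values that the parent value y allows at u; [e] encodes whether the inequality on
    the edge is strict. *)
Definition below (u : I) (y : nat) : nat := ((y * s u + e u) %/ s (par u))%N.

Section Labellings.
Variables n N : nat.
Implicit Types (f g : {ffun I -> 'I_N.+1}).

Definition admissible f (u : I) (x : nat) :=
  (x <= n * s u)%N && ((u == root) || (x < below u (f (par u)))%N).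

(** Values outside S are pinned to 0, so that each labelling of S is counted once although f is
    defined on all of I. *)
Definition labelling S f :=
  [forall u, if u \in S then admissible f u (f u) else f u == ord0].

Definition weighted_count S W : C :=
  \sum_(f | labelling S f) \prod_(u in S) W u (f u).

Definition upd f (u : I) (x : 'I_N.+1) : {ffun I -> 'I_N.+1} :=
  [ffun v => if v == u then x else f v].

Lemma labelling_upd S f u : u \in S ->
  (forall v, v \in S -> v != root -> par v != u) ->
  labelling S f = labelling (S :\ u) (upd f u ord0)
                  && admissible (upd f u ord0) u (f u).
Proof.
move=> uS leaf.
have paru : (u == root) || (par u != u).
  have [//|/ht_par] := eqVneq u root.
  by apply: contraTneq => ->; rewrite ltnn.
have admu x : admissible (upd f u ord0) u x = admissible f u x.
  rewrite /admissible ffunE; case: eqP paru => //= _ /negPf -> //.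
have admv v x : v \in S -> admissible (upd f u ord0) v x = admissible f v x.
  move=> vS; rewrite /admissible ffunE; have [//|vr] := eqVneq v root.
  by rewrite (negPf (leaf v vS vr)).
apply/forallP/andP => [fS|[/forallP fS fu] v].
  split; last by have := fS u; rewrite uS admu.
  apply/forallP => v; have := fS v; rewrite in_setD1 ffunE.
  by have [->|vu] //= := eqVneq v u; case: ifP => // vS; rewrite admv.
have [->|vu] := eqVneq v u; first by rewrite uS -admu.
have := fS v; rewrite in_setD1 ffunE (negPf vu) /=.
by case: ifP => // vS; rewrite admv.
Qed.

Lemma weighted_count_leaf S W u : u \in S ->
  (forall v, v \in S -> v != root -> par v != u) ->
  weighted_count S W = \sum_(g | labelling (S :\ u) g)
    (\prod_(v in S :\ u) W v (g v)) *
    \sum_(x : 'I_N.+1 | admissible g u x) W u x.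
Proof.
move=> uS leaf; rewrite /weighted_count.
(* Labellings are grouped by what remains after resetting the value at u; as u has no child in S, a
   fibre is parametrised by that value alone. *)
rewrite (partition_big (fun f => upd f u ord0) (labelling (S :\ u))) /=;
  last first.
  by move=> f; rewrite (labelling_upd _ uS leaf) => /andP[].
apply: eq_bigr => g gS.
have gu : g u = ord0.
  by move/forallP/(_ u): gS; rewrite in_setD1 eqxx /= => /eqP.
have updK x : upd (upd g u x) u ord0 = g.
  by apply/ffunP => v; rewrite !ffunE; case: eqP => // ->.
rewrite mulr_sumr (reindex_onto (upd g u) (fun f => f u)) /=; last first.
  move=> f /andP[_ /eqP <-]; apply/ffunP => v; rewrite !ffunE.
  by case: eqP => // ->.
apply: eq_big => [x|x _].
  rewrite (labelling_upd _ uS leaf) updK gS /= !ffunE !eqxx.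
  by rewrite !andbT.
rewrite (big_setD1 u) //= mulrC ffunE eqxx; congr (_ * _).
apply: eq_bigr => v; rewrite in_setD1 => /andP[vu _].
by rewrite ffunE (negPf vu).
Qed.

Lemma labelling_bound S g v : labelling S g -> (g v <= n * s v)%N.
Proof.
move=> /forallP/(_ v); case: ifP => _; first by case/andP.
by move/eqP->.
Qed.

Hypothesis n_bound : forall u, (n * s u <= N)%N.

Lemma sum_ord_ltn (F : nat -> C) m : (m <= N.+1)%N ->
  \sum_(x : 'I_N.+1 | (x < m)%N) F x = \sum_(0 <= x < m) F x.
Proof.
by move=> mN; rewrite big_mkord (big_ord_widen N.+1 F mN).
Qed.

Lemma weighted_count_root W :
  weighted_count [set root] W = \sum_(0 <= x < (n * s root).+1) W root x.
Proof.
rewrite (@weighted_count_leaf _ _ root) ?set11 //; last first.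
  by move=> v /set1P ->; rewrite eqxx.
rewrite setDv (big_pred1 [ffun=> ord0]) => [|g]; last first.
  apply/forallP/eqP => [g0|->]; last by move=> v; rewrite in_set0 ffunE.
  by apply/ffunP => v; have := g0 v; rewrite in_set0 ffunE => /eqP.
rewrite big_set0 mul1r -sum_ord_ltn ?ltnS ?n_bound //.
by apply: eq_bigl => x; rewrite /admissible eqxx andbT.
Qed.

Lemma below_bound u y : (y <= n * s (par u))%N -> (below u y <= (n * s u).+1)%N.
Proof.
move=> yn; rewrite /below -ltnS ltn_divLR //.
have h : (y * s u <= n * s u * s (par u))%N.
  by rewrite mulnAC leq_mul2r yn orbT.
have := e_bound u; have := s_gt0 (par u); rewrite !mulSn; lia.
Qed.

(** The sum over the value at the leaf u is absorbed into the weight of its parent. The bound n s(u)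
    at u follows from the bound at the parent by [below_bound]. *)
Lemma weighted_count_elim S W u : u \in S -> u != root -> par u \in S ->
  (forall v, v \in S -> v != root -> par v != u) ->
  weighted_count S W = weighted_count (S :\ u)
    (fun v y => if v == par u then W v y * \sum_(0 <= x < below u y) W u x
                else W v y).
Proof.
move=> uS ur pS leaf; rewrite (weighted_count_leaf _ uS leaf).
apply: eq_bigr => g gS.
have pu : par u != u by apply: contraTneq (ht_par ur) => ->; rewrite ltnn.
have pS' : par u \in S :\ u by rewrite in_setD1 pu.
rewrite (big_setD1 (par u)) //= [in RHS](big_setD1 (par u)) //= eqxx.
have -> : \sum_(x : 'I_N.+1 | admissible g u x) W u x
    = \sum_(0 <= x < below u (g (par u))) W u x.
  have yb := below_bound (labelling_bound (par u) gS).
  rewrite -sum_ord_ltn; last by apply: leq_trans yb _; rewrite ltnS.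
  apply: eq_bigl => x; rewrite /admissible (negPf ur) /=.
  by apply: andb_idl => xb; rewrite -ltnS; apply: leq_trans yb.
rewrite mulrAC; congr (_ * _); apply: eq_bigr => v.
by rewrite !in_setD1 => /andP[/negPf -> _].
Qed.

End Labellings.

Theorem weighted_count_ehr S W D : root \in S ->
  (forall u, u \in S -> u != root -> par u \in S) ->
  (forall u, u \in S -> good_weight (s u) (D u) (W u)) ->
  exists2 f : {poly C}, hurwitz (\sum_(u in S) (D u).+1) f &
    forall n N, (forall u, n * s u <= N)%N ->
      weighted_count n N S W = ehr (\sum_(u in S) (D u).+1) f n.
Proof.
move: {2}#|S| (erefl #|S|) => c; elim: c S W D => [|c IHc] S W D.
  by move/eqP; rewrite cards_eq0 => /eqP ->; rewrite in_set0.
move=> cS rS closed gW.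
have [S1|[u0]] := set_0Vmem (S :\ root).
  have -> : S = [set root].
    by rewrite -(setD1K rS) S1 setU0.
  have [f fH fE] := good_weight_root (s_gt0 root) (gW root rS).
  rewrite big_set1; exists f => // n N nN.
  by rewrite weighted_count_root // fE.
(* A non-root element of least height has no child in S. *)
move=> u0S; case: (@arg_minnP _ u0 (mem (S :\ root)) ht u0S) => u.
rewrite /= in_setD1 => /andP[ur uS] u_min.
have leaf v : v \in S -> v != root -> par v != u.
  move=> vS vr; apply: contraTneq (ht_par vr) => ->.
  by rewrite -leqNgt; apply: u_min; rewrite /= in_setD1 vr.
have pS := closed u uS ur.
have pu : par u != u by apply: contraTneq (ht_par ur) => ->; rewrite ltnn.
have pS' : par u \in S :\ u by rewrite in_setD1 pu.
(* The parent receives the degree of the partial sums at u, which keeps the total degree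
   unchanged. *)
pose D' v := if v == par u then (D v + (D u).+1)%N else D v.
have eqD : (\sum_(v in S :\ u) (D' v).+1 = \sum_(v in S) (D v).+1)%N.
  rewrite [RHS](big_setD1 u) //= (big_setD1 (par u)) //=.
  rewrite [in RHS](big_setD1 (par u)) //= /D' eqxx -addSn -addnA [RHS]addnCA.
  congr (_ + (_ + _))%N; apply: eq_bigr => v.
  by rewrite !in_setD1 => /andP[/negPf -> _].
have [||||f fH fE] := IHc (S :\ u) (fun v y => if v == par u
    then W v y * \sum_(0 <= x < below u y) W u x else W v y) D'.
- by move: cS; rewrite (cardsD1 u) uS => -[].
- by rewrite in_setD1 eq_sym ur.
- by move=> v; rewrite !in_setD1 => /andP[vu vS] vr; rewrite leaf // closed.
- move=> v; rewrite in_setD1 /D' => /andP[vu vS].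
  have [->|_] := eqVneq v (par u); last exact: gW.
  by apply: good_weight_child => //; apply: gW.
rewrite eqD in fH fE; exists f => // n N nN.
by rewrite (weighted_count_elim _ _ uS ur pS leaf) // fE.
Qed.

End Tree.

From mathcomp Require Import finmap boolp classical_sets cardinality.

(** * Rooted trees and lattice points *)

Section SeriesNumerator.
Variable A : comNzRingType.
Implicit Types (f : {poly A}).

(** The polynomial factor truncates f / (1 - X)^(D+1) after degree N. By Pascal's rule one factor 1
    - X lowers D by one. *)
Lemma coef_1subX_ehr_conv D f n N : (n <= N)%N ->
  ((1 - 'X) ^+ D.+1 * \poly_(m < N.+1)
     \sum_(i < m.+1) f`_i * 'C(m - i + D, D)%:R)`_n = f`_n.
Proof.
have coef1X (p : {poly A}) k : ((1 - 'X) * p)`_k = p`_k - (if k is l.+1 then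
  p`_l else 0).
  by rewrite mulrBl mul1r coefB coefXM; case: k.
elim: D n => [|D IHD] n nN.
  rewrite expr1 coef1X !coef_poly ltnS nN; case: n nN => [|n] nN.
    by rewrite big_ord1 bin0 mulr1 subr0.
  rewrite coef_poly (leq_trans nN) // big_ord_recr /=.
  under eq_bigr do rewrite bin0 mulr1.
  under [X in _ - X]eq_bigr do rewrite bin0 mulr1.
  by rewrite bin0 mulr1 addrAC subrr add0r.
rewrite exprSr -mulrA -[RHS]IHD // !coefM; apply: eq_bigr => k _; congr (_ * _).
have mN : (n - k <= N)%N by lia.
move: (n - k)%N mN => m mN; rewrite coef1X !coef_poly ltnS mN.
case: m mN => [|m] mN; first by rewrite !big_ord1 subr0 subnn !binn.
rewrite coef_poly (leq_trans mN) // !(big_ord_recr m.+1) /= subnn !binn.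
rewrite addrAC -sumrB; congr (_ + _); apply: eq_bigr => i _.
rewrite -mulrBr; congr (_ * _); have := ltn_ord i => im.
rewrite (_ : (m.+1 - i + D.+1 = (m - i + D.+1).+1)%N); last by lia.
rewrite binS natrD addrC addKr; congr (('C(_, _))%:R); lia.
Qed.

Lemma coef_1subX_ehr D f n : (size f <= D.+1)%N ->
  f`_n = \sum_(k < n.+1) ((1 - 'X) ^+ D.+1)`_k * ehr D f (n - k).
Proof.
move=> sf; rewrite -(coef_1subX_ehr_conv D f (leqnn n)) coefM.
apply: eq_bigr => k _; rewrite coef_poly ltnS leq_subr; congr (_ * _).
move: (n - k)%N => m; rewrite /ehr.
have bound a b (F : nat -> A) : (a <= b)%N ->
    (forall i, (a <= i)%N -> F i = 0) -> \sum_(i < a) F i = \sum_(i < b) F i.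
  move=> ab F0; rewrite (big_ord_widen b F ab) big_mkcond;
    apply: eq_bigr => i _.
  by case: ltnP => // /F0.
(* Both sums are extended to i <= m + D: beyond D the coefficients of f vanish, and for m < i <= D
   the binomial does. *)
rewrite (@bound _ (m + D).+1 (fun i => f`_i * 'C(m + D - i, D)%:R));
  last 2 first.
- by rewrite ltnS leq_addl.
- by move=> i Di; rewrite nth_default ?mul0r // (leq_trans sf).
have -> : \sum_(i < m.+1) f`_i * 'C(m - i + D, D)%:R
    = \sum_(i < m.+1) f`_i * ('C(m + D - i, D) * (i <= m))%:R.
  apply: eq_bigr => i _; have im : (i <= m)%N by rewrite -ltnS.
  by rewrite im muln1 addnBAC.
rewrite (@bound _ (m + D).+1 (fun i =>
  f`_i * ('C(m + D - i, D) * (i <= m))%:R)); last 2 first.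
- by rewrite ltnS leq_addr.
- by move=> i mi; rewrite leqNgt mi muln0 mulr0.
apply: eq_bigr => i _; case: leqP => [|mi]; first by rewrite muln1.
rewrite muln0 mulr0; have [Di|iD] := ltnP D i;
  first by rewrite nth_default ?mul0r // (leq_trans sf).
by rewrite bin_small ?mulr0 //; lia.
Qed.

End SeriesNumerator.

(** * The parent function of a rooted tree *)

Section RootedTree.
Variables (d : nat) (rel_P : rel 'I_d).
Hypothesis hP : rooted_tree rel_P.

(** A strictly increasing integer rank: it gives minimal elements, measures inductions and serves as
    the height in leaf elimination. *)
Definition down_size (i : 'I_d) := #|[set j | rel_P j i]|.

Lemma down_size_lt i j : strict rel_P i j -> (down_size i < down_size j)%N.
Proof.
case: hP => [[rP aP tP] _] /andP[ij Pij]; apply/proper_card/properP; split.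
  by apply/fintype.subsetP => k; rewrite !inE => /tP; apply.
exists j; rewrite inE; first exact: rP.
by apply: contra ij => Pji; apply/eqP/aP; rewrite Pij.
Qed.

Lemma strict_trans i j k : strict rel_P i j -> strict rel_P j k ->
  strict rel_P i k.
Proof.
case: hP => [[rP aP tP] _] ij jk; have := down_size_lt ij;
  have := down_size_lt jk.
move: ij jk => /andP[_ ij] /andP[_ jk];
  rewrite /strict (tP _ _ _ ij jk) andbT => jk' ij'.
by apply: contraTneq ij' => ->; rewrite -leqNgt ltnW.
Qed.

Lemma strict_cover i j : strict rel_P i j ->
  exists2 k, covered_by rel_P i k & k = j \/ strict rel_P k j.
Proof.
move=> ij; pose above k := strict rel_P i k && ((k == j) || strict rel_P k j).
have aj : above j by rewrite /above ij eqxx.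
case: (@arg_minnP _ j above down_size aj) => k /andP[ik kj] k_min.
exists k; last by case/orP: kj => [/eqP|]; [left|right].
split=> // -[l [il lk]]; suff /k_min : above l by rewrite leqNgt down_size_lt.
rewrite /above il /=; apply/orP; right.
by case/orP: kj => [/eqP <-|/(strict_trans lk)].
Qed.

(** Every j above i lies at or above some cover of i by [strict_cover], and the cover is unique. The
    value of [par] at the root is arbitrary. *)
Lemma tree_parent : exists (root : 'I_d) (par : 'I_d -> 'I_d),
  (forall i, i != root -> strict rel_P i (par i)) /\
  (forall i j, strict rel_P i j ->
     i != root /\ (par i = j \/ strict rel_P (par i) j)).
Proof.
case: (hP) => _ [root [max_root _ cover]].
have [i|par par_cover] := @choice 'I_d 'I_d (fun i j =>
  i <> root -> covered_by rel_P i j).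
  have [->|/eqP ir] := eqVneq i root; first by exists root.
  by have [j [cj _]] := cover i ir; exists j.
exists root, par; split=> [i /eqP/par_cover[] //|i j ij].
have ir : i <> root by move=> ir; case: (max_root j); rewrite -ir.
split; first exact/eqP.
have [k ik kj] := strict_cover ij.
have [j' [_ uniq_j']] := cover i ir.
by rewrite -(uniq_j' _ (par_cover i ir)) (uniq_j' _ ik).
Qed.

End RootedTree.

(** * Lattice points as labellings of the tree *)

Section LatticePoints.
Variables (R : realType) (d : nat) (rel_P : rel 'I_d) (s : 'I_d -> nat).
Variables (root : 'I_d) (par : 'I_d -> 'I_d).
Hypothesis hP : rooted_tree rel_P.
Hypothesis s_gt0 : forall i, (0 < s i)%N.
Hypothesis par_strict : forall i, i != root -> strict rel_P i (par i).
Hypothesis par_first : forall i j, strict rel_P i j ->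
  i != root /\ (par i = j \/ strict rel_P (par i) j).

(** With q = s(par u), x < (y s(u) + e) %/ q means x q + q <= y s(u) + e: a weak inequality for e =
    q and a strict one for e = q - 1. *)
Definition slack (u : 'I_d) : nat :=
  if (par u < u)%N then (s (par u)).-1 else s (par u).

Lemma lt_below (u : 'I_d) x y :
  (x < below par s slack u y)%N = if (par u < u)%N then (x * s (par u) < y * s
    u)%N
                                  else (x * s (par u) <= y * s u)%N.
Proof.
have := s_gt0 (par u); rewrite /below leq_divRL // /slack mulSn.
by case: ifP => _ ?; apply/idP/idP; lia.
Qed.

Lemma ratio_le (i j : 'I_d) (x y : nat) :
  ((x%:R / (s i)%:R : R) <= y%:R / (s j)%:R) = (x * s j <= y * s i)%N.
Proof. by rewrite ler_pdivrMr ?ltr0n // mulrAC ler_pdivlMr ?ltr0n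
  // -!natrM ler_nat. Qed.

Lemma ratio_lt (i j : 'I_d) (x y : nat) :
  ((x%:R / (s i)%:R : R) < y%:R / (s j)%:R) = (x * s j < y * s i)%N.
Proof. by rewrite ltr_pdivrMr ?ltr0n // mulrAC ltr_pdivlMr ?ltr0n
  // -!natrM ltr_nat. Qed.

(** Inequalities on edges compose along the path from i up to j. If j < i as labels, the label drops
    on some edge of this path, and the inequality is strict there. *)
Lemma Ps_partition_edges (f : {ffun 'I_d -> R}) :
  (forall u, u != root -> if (par u < u)%N
     then f u / (s u)%:R < f (par u) / (s (par u))%:R
     else f u / (s u)%:R <= f (par u) / (s (par u))%:R) ->
  Ps_partition rel_P s f.
Proof.
move=> edge; suff H i j : strict rel_P i j ->
    f i / (s i)%:R <= f j / (s j)%:R /\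
    ((j < i)%N -> f i / (s i)%:R < f j / (s j)%:R).
  by split=> i j /H [].
move: {2}(d - _)%N (leqnn (d - down_size rel_P i)) => m.
elim: m i => [|m IHm] i.
  rewrite leqn0 subn_eq0 => di /(down_size_lt hP).
  by rewrite ltnNge (leq_trans _ di) // -[X in (_ <= X)%N]card_ord max_card.
move=> im ij; have [ir par_ij] := par_first ij; have := edge i ir.
have par_le : f i / (s i)%:R <= f (par i) / (s (par i))%:R.
  by have := edge i ir; case: ifP => // _ /ltW.
case: par_ij => [<-|pij] e; first by split=> // ji; move: e; rewrite ji.
have [|le_pj lt_pj] := IHm (par i) _ pij.
  have := down_size_lt hP (par_strict ir); have := down_size_lt hP pij.
  by move: im; lia.
split; first exact: le_trans le_pj.
(* Either the first edge already drops, or j < i <= par i and the induction hypothesis gives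
   strictness above. *)
move=> ji; have [pi|ip] := ltnP (par i) i.
  by move: e; rewrite pi => /lt_le_trans; apply.
by apply: le_lt_trans par_le (lt_pj _); apply: leq_trans ip.
Qed.

Definition lattice_point N (g : {ffun 'I_d -> 'I_N.+1}) : {ffun 'I_d -> R} :=
  [ffun i => (nat_of_ord (g i))%:R].

Lemma lattice_pointsE n N : (forall u, n * s u <= N)%N ->
  (@lecture_hall_dilate R d rel_P s n `&` @integer_lattice R d =
  [set` [fset lattice_point g | g in
     [pred g : {ffun 'I_d -> 'I_N.+1} |
       labelling root par s slack n finset.setT g]]%fset])%classic.
Proof.
move=> nN; apply/seteqP; split=> f /=; last first.
  case/imfsetP => g /= /forallP gP ->.
  have {}gP u : (g u <= n * s u)%N && ((u == root) || (g u < below par s slack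
    u (g (par u)))%N).
    by have := gP u; rewrite finset.inE.
  split; last by move=> i; rewrite ffunE natr_int.
  split; last first.
    move=> i; rewrite ffunE divr_ge0 ?ler0n //= ler_pdivrMr ?ltr0n //.
    by rewrite -natrM ler_nat; have /andP[] := gP i.
  apply: Ps_partition_edges => u ur; have /andP[_] := gP u.
  by rewrite (negPf ur) /= lt_below !ffunE ratio_le ratio_lt //.
case=> [[[weak strong] f_bound] f_int].
have f_nat i : exists2 x : nat, f i = x%:R & (x <= n * s i)%N.
  have /andP[f0 fn] := f_bound i.
  have s0 : 0 < (s i)%:R :> R by rewrite ltr0n.
  have fi0 : 0 <= f i by move: f0; rewrite pmulr_lge0 // invr_gt0.
  have /natrP[x fx] : f i \is a Num.nat by rewrite natrEint f_int.
  by exists x => //; move: fn; rewrite fx ler_pdivrMr // -natrM ler_nat.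
have [x fx] := choice (fun i =>
  let: ex_intro2 x e l := f_nat i in ex_intro _ x (conj e l)).
have xN i : (x i < N.+1)%N by rewrite ltnS (leq_trans _ (nN i)) //;
  case: (fx i).
apply/imfsetP; exists [ffun i => Ordinal (xN i)] => /=; last first.
  by apply/ffunP => i; rewrite !ffunE; case: (fx i).
apply/forallP => u; rewrite finset.inE /admissible !ffunE /=.
have [_ -> /=] := fx u; have [//|ur] := eqVneq u root.
have up := par_strict ur.
rewrite lt_below /=; case: ifP => pu.
  by have := strong _ _ up pu; have [-> _] := fx u; have [-> _] := fx (par u);
    rewrite ratio_lt.
by have := weak _ _ up; have [-> _] := fx u; have [-> _] := fx (par u);
  rewrite ratio_le.
Qed.

Lemma ehrhart_count n N : (forall u, n * s u <= N)%N ->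
  (ehrhart R rel_P s n)%:R =
  @weighted_count R _ root par s slack n N finset.setT (fun _ _ => 1).
Proof.
move=> nN; rewrite /ehrhart (lattice_pointsE nN) set_fsetK card_imfset /=;
  last first.
  move=> g1 g2 /ffunP eqg; apply/ffunP => i; apply/val_inj/eqP.
  by have := eqg i; rewrite !ffunE => /eqP; rewrite eqr_nat.
rewrite -cardE /weighted_count; rewrite -sumr_const; apply: eq_bigr => g _.
by rewrite big1.
Qed.

End LatticePoints.

Theorem theorem1p2 (R : realType) (d : nat) (hd : (1 <= d)%N)
    (rel_P : rel 'I_d) (hP : rooted_tree rel_P)
    (s : 'I_d -> nat) (hs : forall i, (0 < s i)%N) :
  exists h : {poly int}, is_hstar R rel_P s h /\ real_rooted R h.
Proof.
have [root [par [par_strict par_first]]] := tree_parent hP.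
have ht_par u : u != root -> (down_size rel_P u < down_size rel_P (par u))%N.
  by move=> /par_strict; apply: down_size_lt.
have e_bound u : ((s (par u)).-1 <= slack s par u <= s (par u))%N.
  by rewrite /slack; case: ifP => _; rewrite leqnn leq_pred.
(* Initially every vertex has weight 1 and degree 0, so the total degree is d. *)
have [||u _|f fH fE] :=
  @weighted_count_ehr R _ root par (down_size rel_P) s (slack s par)
    ht_par hs e_bound finset.setT (fun _ _ => 1) (fun=> 0%N) => //.
  by left.
move: fH fE; rewrite sum1_card finset.cardsT card_ord => -[sf f0 fH] fE.
have ehrE n : (ehrhart R rel_P s n)%:R = ehr d f n.
  have nN u : (n * s u <= n * \sum_i s i)%N
    by rewrite leq_mul2l (bigD1 u) //= leq_addr orbT.
  by rewrite (ehrhart_count R hP hs par_strict par_first nN) fE.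
(* The integers prescribed by [is_hstar] agree with the coefficients of the complex polynomial f, so
   f comes from an integer polynomial. *)
pose c n : int := \sum_(k < n.+1) ((1 - 'X : {poly int}) ^+ d.+1)`_k
                           * (ehrhart R rel_P s (n - k))%:Z.
have cE n : (c n)%:~R = f`_n.
  rewrite (coef_1subX_ehr n sf) rmorph_sum; apply: eq_bigr => k _.
  rewrite rmorphM /= -ehrE -coef_map rmorphXn rmorphB rmorph1 /= map_polyX.
  by rewrite -pmulrn.
exists (\poly_(n < d.+1) c n); split.
  (* Beyond degree d the prescribed integers vanish because the coefficients of f do. *)
  move=> n; rewrite coef_poly; case: ltnP => // dn; apply/eqP.
  rewrite eq_sym -(@intr_eq0 R[i]) -/(c n) cE nth_default //.
  exact: leq_trans dn.
move=> z; have -> : map_poly intr (\poly_(n < d.+1) c n) = f.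
  apply/polyP => n; rewrite coef_map coef_poly /=; case: ltnP => [_|dn];
    first exact: cE.
  by rewrite nth_default // (leq_trans sf).
move=> /(root_nonneg f0 fH) []; case: z => a b /= -> _.
by rewrite complex_real.
Qed.
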